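(* If Markov's principle holds and either $\mathbb{N}^{\mathbb{N}}$ or $2^{\mathbb{N}}$ has the $\neg\neg$ strong Myhill property, then the limited principle of omniscience $\mathsf{LPO}$ holds.
   Context: The statement is to be proved constructively (intuitionistic set theory with powersets and $\mathbb{N}$, equivalently the internal logic of a topos with natural numbers object; neither excluded middle nor choice is assumed). Markov's principle: for every $p \in 2^{\mathbb{N}}$, if $p \neq 0^\omega$ (the constant $0$ sequence), then there exists $n$ with $p_n = 1$. $\mathsf{LPO}$: for every $p \in 2^{\mathbb{N}}$, either $p = 0^\omega$ or there exists $n$ with $p_n = 1$. For injections $f, g : X \to X$ and $m \in \mathbb{Z}$, let $R^{f,g}_m \subseteq X \times X$ be the partial injection $f \circ (g \circ f)^m$: for $m \ge 0$, $(x,y) \in R^{f,g}_m$ iff $y = f((g\circ f)^m(x))$; for $m < 0$, $(x,y) \in R^{f,g}_m$ iff $x = g((f \circ g)^{-m-1}(y))$. A set $X$ has the $\neg\neg$ strong Myhill property if for every pair of injections $f, g : X \to X$ there is a bijection $h : X \to X$ such that for every $x \in X$, $\neg\neg\, \exists m \in \mathbb{Z}.\ (x,h(x)) \in R^{f,g}_m$. *)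

(* Defs.v *)
(* The theorem is about intuitionistic provability: its conclusion is a classical
   tautology, so it has content only relative to a logic without excluded middle
   and choice.  That logic is therefore made explicit: below is intuitionistic
   higher-order logic with the natural numbers (the internal logic of toposes
   with a natural numbers object), as a natural-deduction calculus. *)

From Stdlib Require Import List.
Import ListNotations.

Set Implicit Arguments.
Unset Strict Implicit.

(* [Om] is the type of truth values, so [Arr s Om] is the power type of [s].
   A set in the mathematical statement is a type here.  Binary products and the
   unit type are omitted: adding them is conservative. *)
Inductive ty : Type :=
| Om : ty
| Two : ty
| Nn : ty
| Arr : ty -> ty -> ty.

Notation ctx := (list ty).

Inductive var : ctx -> ty -> Type :=
| vz : forall (G : ctx) (s : ty), var (s :: G) s
| vs : forall (G : ctx) (s t : ty), var G s -> var (t :: G) s.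

Arguments vz {G s}.
Arguments vs {G s t} _.

Inductive tm : ctx -> ty -> Type :=
| Var : forall G s, var G s -> tm G s
| Lam : forall G s t, tm (s :: G) t -> tm G (Arr s t)
| App : forall G s t, tm G (Arr s t) -> tm G s -> tm G t
| Eq : forall G s, tm G s -> tm G s -> tm G Om
| Bot : forall G, tm G Om
| And : forall G, tm G Om -> tm G Om -> tm G Om
| Or : forall G, tm G Om -> tm G Om -> tm G Om
| Imp : forall G, tm G Om -> tm G Om -> tm G Om
| All : forall G s, tm (s :: G) Om -> tm G Om
| Ex : forall G s, tm (s :: G) Om -> tm G Om
| Zero : forall G, tm G Nn
| Succ : forall G, tm G Nn -> tm G Nn
| Rec : forall G s, tm G s -> tm G (Arr Nn (Arr s s)) -> tm G Nn -> tm G s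
| FF : forall G, tm G Two
| TT : forall G, tm G Two
| Ite : forall G s, tm G Two -> tm G s -> tm G s -> tm G s.

Arguments Var {G s} _.
Arguments Lam {G} s {t} _.
Arguments Bot {G}.
Arguments All {G} s _.
Arguments Ex {G} s _.
Arguments Zero {G}.
Arguments FF {G}.
Arguments TT {G}.

Declare Scope hol_scope.
Delimit Scope hol_scope with hol.
Bind Scope hol_scope with tm.
Bind Scope hol_scope with ty.

Notation "s ~> t" := (Arr s t) (at level 55, right associativity) : hol_scope.
Notation "f @ a" := (App f a) (at level 40, left associativity) : hol_scope.
Notation "a == b" := (Eq a b) (at level 70, no associativity) : hol_scope.
Notation "a //\\ b" := (And a b) (at level 75, right associativity) : hol_scope.
Notation "a \\// b" := (Or a b) (at level 76, right associativity) : hol_scope.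
Notation "a ==> b" := (Imp a b) (at level 77, right associativity) : hol_scope.
Notation Not a := (Imp a Bot).

Notation "#0" := (Var vz) : hol_scope.
Notation "#1" := (Var (vs vz)) : hol_scope.
Notation "#2" := (Var (vs (vs vz))) : hol_scope.
Notation "#3" := (Var (vs (vs (vs vz)))) : hol_scope.
Notation "#4" := (Var (vs (vs (vs (vs vz))))) : hol_scope.
Notation "#5" := (Var (vs (vs (vs (vs (vs vz)))))) : hol_scope.

Local Open Scope hol_scope.

Definition scons (P : ty -> Type) (G : ctx) (t : ty) (a : P t)
    (f : forall s, var G s -> P s) (s : ty) (v : var (t :: G) s) : P s :=
  match v in var G' s' return
    match G' with
    | [] => unit
    | t' :: D => P t' -> (forall s, var D s -> P s) -> P s'
    end
  with
  | vz => fun a _ => a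
  | vs w => fun _ f => f _ w
  end a f.

Definition rup (G D : ctx) (r : forall s, var G s -> var D s) (t : ty) :
    forall s, var (t :: G) s -> var (t :: D) s :=
  scons (P := var (t :: D)) vz (fun s v => vs (r s v)).

Fixpoint ren (G D : ctx) (s : ty) (r : forall s, var G s -> var D s)
    (a : tm G s) {struct a} : tm D s :=
  match a in tm G' s' return (forall s, var G' s -> var D s) -> tm D s' with
  | Var v => fun r => Var (r _ v)
  | Lam s b => fun r => Lam s (ren (rup r (t := s)) b)
  | App f b => fun r => App (ren r f) (ren r b)
  | Eq b c => fun r => Eq (ren r b) (ren r c)
  | Bot => fun _ => Bot
  | And b c => fun r => And (ren r b) (ren r c)
  | Or b c => fun r => Or (ren r b) (ren r c)
  | Imp b c => fun r => Imp (ren r b) (ren r c)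
  | All s b => fun r => All s (ren (rup r (t := s)) b)
  | Ex s b => fun r => Ex s (ren (rup r (t := s)) b)
  | Zero => fun _ => Zero
  | Succ n => fun r => Succ (ren r n)
  | Rec b c n => fun r => Rec (ren r b) (ren r c) (ren r n)
  | FF => fun _ => FF
  | TT => fun _ => TT
  | Ite b c d => fun r => Ite (ren r b) (ren r c) (ren r d)
  end r.

Definition wk {G : ctx} {s t : ty} (a : tm G s) : tm (t :: G) s :=
  ren (fun _ v => vs v) a.

Definition sup (G D : ctx) (r : forall s, var G s -> tm D s) (t : ty) :
    forall s, var (t :: G) s -> tm (t :: D) s :=
  scons (P := tm (t :: D)) (Var vz) (fun s v => wk (r s v)).

Fixpoint sub (G D : ctx) (s : ty) (r : forall s, var G s -> tm D s)
    (a : tm G s) {struct a} : tm D s :=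
  match a in tm G' s' return (forall s, var G' s -> tm D s) -> tm D s' with
  | Var v => fun r => r _ v
  | Lam s b => fun r => Lam s (sub (sup r (t := s)) b)
  | App f b => fun r => App (sub r f) (sub r b)
  | Eq b c => fun r => Eq (sub r b) (sub r c)
  | Bot => fun _ => Bot
  | And b c => fun r => And (sub r b) (sub r c)
  | Or b c => fun r => Or (sub r b) (sub r c)
  | Imp b c => fun r => Imp (sub r b) (sub r c)
  | All s b => fun r => All s (sub (sup r (t := s)) b)
  | Ex s b => fun r => Ex s (sub (sup r (t := s)) b)
  | Zero => fun _ => Zero
  | Succ n => fun r => Succ (sub r n)
  | Rec b c n => fun r => Rec (sub r b) (sub r c) (sub r n)
  | FF => fun _ => FF
  | TT => fun _ => TT
  | Ite b c d => fun r => Ite (sub r b) (sub r c) (sub r d)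
  end r.

(* [inst a b] is b[a/#0]. *)
Definition inst (G : ctx) (s t : ty) (a : tm G s) (b : tm (s :: G) t) : tm G t :=
  sub (scons (P := tm G) a (fun _ v => Var v)) b.

(* [prv H p]: the formula p is derivable from the hypotheses H, all of them in
   the variable context G.  There is no rule for excluded middle, and the only
   choice principle is unique choice, valid in every topos: functions are the
   total single-valued relations. *)
Inductive prv : forall G : ctx, list (tm G Om) -> tm G Om -> Prop :=
| pAx : forall G (H : list (tm G Om)) p, In p H -> prv H p
| pBotE : forall G (H : list (tm G Om)) p, prv H Bot -> prv H p
| pAndI : forall G (H : list (tm G Om)) p q,
    prv H p -> prv H q -> prv H (p //\\ q)
| pAndE1 : forall G (H : list (tm G Om)) p q, prv H (p //\\ q) -> prv H p
| pAndE2 : forall G (H : list (tm G Om)) p q, prv H (p //\\ q) -> prv H q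
| pOrI1 : forall G (H : list (tm G Om)) p q, prv H p -> prv H (p \\// q)
| pOrI2 : forall G (H : list (tm G Om)) p q, prv H q -> prv H (p \\// q)
| pOrE : forall G (H : list (tm G Om)) p q r,
    prv H (p \\// q) -> prv (p :: H) r -> prv (q :: H) r -> prv H r
| pImpI : forall G (H : list (tm G Om)) p q, prv (p :: H) q -> prv H (p ==> q)
| pImpE : forall G (H : list (tm G Om)) p q,
    prv H (p ==> q) -> prv H p -> prv H q
| pAllI : forall G (H : list (tm G Om)) s (p : tm (s :: G) Om),
    prv (map (@wk G Om s) H) p -> prv H (All s p)
| pAllE : forall G (H : list (tm G Om)) s (p : tm (s :: G) Om) (a : tm G s),
    prv H (All s p) -> prv H (inst a p)
| pExI : forall G (H : list (tm G Om)) s (p : tm (s :: G) Om) (a : tm G s),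
    prv H (inst a p) -> prv H (Ex s p)
| pExE : forall G (H : list (tm G Om)) s (p : tm (s :: G) Om) r,
    prv H (Ex s p) -> prv (p :: map (@wk G Om s) H) (wk r) -> prv H r
| pRefl : forall G (H : list (tm G Om)) s (a : tm G s), prv H (a == a)
| pSubst : forall G (H : list (tm G Om)) s (p : tm (s :: G) Om) (a b : tm G s),
    prv H (a == b) -> prv H (inst a p) -> prv H (inst b p)
| pBeta : forall G (H : list (tm G Om)) s t (b : tm (s :: G) t) (a : tm G s),
    prv H (Lam s b @ a == inst a b)
| pFunExt : forall G (H : list (tm G Om)) s t (f g : tm G (s ~> t)),
    prv H (All s (wk f @ #0 == wk g @ #0)) -> prv H (f == g)
| pPropExt : forall G (H : list (tm G Om)) p q,
    prv H (p ==> q) -> prv H (q ==> p) -> prv H (p == q)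
| pUniqueChoice : forall G (H : list (tm G Om)) s t (R : tm G (s ~> t ~> Om)),
    prv H (All s (Ex t (wk (wk R) @ #1 @ #0 //\\
                        All t (wk (wk (wk R)) @ #2 @ #0 ==> #0 == #1)))) ->
    prv H (Ex (s ~> t) (All s (wk (wk R) @ #0 @ (#1 @ #0))))
| pZeroSucc : forall G (H : list (tm G Om)) (n : tm G Nn),
    prv H (Zero == Succ n) -> prv H Bot
| pSuccInj : forall G (H : list (tm G Om)) (n m : tm G Nn),
    prv H (Succ n == Succ m) -> prv H (n == m)
| pInd : forall G (H : list (tm G Om)) (P : tm G (Nn ~> Om)),
    prv H (P @ Zero) ->
    prv H (All Nn (wk P @ #0 ==> wk P @ Succ #0)) ->
    prv H (All Nn (wk P @ #0))
| pRecZero : forall G (H : list (tm G Om)) s (a : tm G s) f,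
    prv H (Rec a f Zero == a)
| pRecSucc : forall G (H : list (tm G Om)) s (a : tm G s) f n,
    prv H (Rec a f (Succ n) == f @ n @ Rec a f n)
| pFalseTrue : forall G (H : list (tm G Om)), prv H (FF == TT) -> prv H Bot
| pTwoCases : forall G (H : list (tm G Om)) (P : tm G (Two ~> Om)),
    prv H (P @ FF) -> prv H (P @ TT) -> prv H (All Two (wk P @ #0))
| pIteTrue : forall G (H : list (tm G Om)) s (a b : tm G s),
    prv H (Ite TT a b == a)
| pIteFalse : forall G (H : list (tm G Om)) s (a b : tm G s),
    prv H (Ite FF a b == b).

(* The closed terms below are polymorphic in the ambient context G so that they can
   be used under binders without weakening. *)

Definition Cantor : ty := Nn ~> Two.
Definition Baire : ty := Nn ~> Nn.

Definition zeros {G} : tm G Cantor := Lam Nn FF.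

Definition Markov {G} : tm G Om :=
  All Cantor (Not (#0 == zeros) ==> Ex Nn (#1 @ #0 == TT)).

Definition LPO {G} : tm G Om :=
  All Cantor (#0 == zeros \\// Ex Nn (#1 @ #0 == TT)).

Definition injective {G} (X : ty) : tm G ((X ~> X) ~> Om) :=
  Lam (X ~> X) (All X (All X (#2 @ #1 == #2 @ #0 ==> #1 == #0))).

Definition surjective {G} (X : ty) : tm G ((X ~> X) ~> Om) :=
  Lam (X ~> X) (All X (Ex X (#2 @ #0 == #1))).

Definition bijective {G} (X : ty) : tm G ((X ~> X) ~> Om) :=
  Lam (X ~> X) (injective X @ #0 //\\ surjective X @ #0).

Definition comp {G} (X : ty) : tm G ((X ~> X) ~> (X ~> X) ~> X ~> X) :=
  Lam (X ~> X) (Lam (X ~> X) (Lam X (#2 @ (#1 @ #0)))).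

(* [iter X @ f @ n @ x] is the n-fold iterate of f at x. *)
Definition iter {G} (X : ty) : tm G ((X ~> X) ~> Nn ~> X ~> X) :=
  Lam (X ~> X) (Lam Nn (Lam X (Rec #0 (Lam Nn #3) #1))).

(* [orbit X @ f @ g @ s @ k @ x @ y] is (x, y) \in R^{f,g}_m, where the integer
   m is coded by a sign s and a natural number k as
     (FF, k) |-> k      and      (TT, k) |-> - k - 1. *)
Definition orbit {G} (X : ty) :
    tm G ((X ~> X) ~> (X ~> X) ~> Two ~> Nn ~> X ~> X ~> Om) :=
  Lam (X ~> X) (Lam (X ~> X) (Lam Two (Lam Nn (Lam X (Lam X
    (Ite #3
       (#1 == #4 @ (iter X @ (comp X @ #5 @ #4) @ #2 @ #0))
       (#0 == #5 @ (iter X @ (comp X @ #4 @ #5) @ #2 @ #1)))))))).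

Definition nnStrongMyhill {G} (X : ty) : tm G Om :=
  All (X ~> X) (All (X ~> X)
    (injective X @ #1 //\\ injective X @ #0 ==>
     Ex (X ~> X)
       (bijective X @ #0 //\\
        All X (Not (Not (Ex Two (Ex Nn
          (orbit X @ #5 @ #4 @ #1 @ #0 @ #2 @ (#3 @ #2))))))))).

(* Not used in the statement: reading the formulas above in Rocq's own types
   displays them with named variables, as [..._std] check by conversion. *)

Fixpoint dty (s : ty) : Type :=
  match s with
  | Om => Prop
  | Two => bool
  | Nn => nat
  | Arr s t => dty s -> dty t
  end.

Fixpoint den (G : ctx) (s : ty) (a : tm G s) :
    (forall s, var G s -> dty s) -> dty s :=
  match a in tm G s return (forall s, var G s -> dty s) -> dty s with
  | Var v => fun e => e _ v
  | Lam s b => fun e x => den b (scons (P := dty) x e)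
  | App f b => fun e => den f e (den b e)
  | Eq b c => fun e => den b e = den c e
  | Bot => fun _ => False
  | And b c => fun e => den b e /\ den c e
  | Or b c => fun e => den b e \/ den c e
  | Imp b c => fun e => den b e -> den c e
  | All s b => fun e => forall x, den b (scons (P := dty) x e)
  | Ex s b => fun e => exists x, den b (scons (P := dty) x e)
  | Zero => fun _ => 0
  | Succ n => fun e => S (den n e)
  | Rec b c n => fun e => nat_rect (fun _ => _) (den b e) (den c e) (den n e)
  | FF => fun _ => false
  | TT => fun _ => true
  | Ite b c d => fun e => if den b e then den c e else den d e
  end.

Lemma Markov_std (G : ctx) (e : forall s, var G s -> dty s) :
  den Markov e =
  (forall p : nat -> bool, ~ (p = fun _ => false) -> exists n, p n = true).
Proof. reflexivity. Qed.

Lemma LPO_std (G : ctx) (e : forall s, var G s -> dty s) :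
  den LPO e =
  (forall p : nat -> bool, p = (fun _ => false) \/ exists n, p n = true).
Proof. reflexivity. Qed.

Lemma nnStrongMyhill_std (X : ty) (G : ctx) (e : forall s, var G s -> dty s) :
  den (nnStrongMyhill X) e =
  (forall f g : dty X -> dty X,
     (forall x y, f x = f y -> x = y) /\ (forall x y, g x = g y -> x = y) ->
     exists h : dty X -> dty X,
       ((forall x y, h x = h y -> x = y) /\ (forall y, exists x, h x = y)) /\
       forall x, ~ ~ exists (s : bool) (k : nat),
         if s
         then x = g (nat_rect _ (h x) (fun _ z => f (g z)) k)
         else h x = f (nat_rect _ x (fun _ z => g (f z)) k)).
Proof. reflexivity. Qed.

(* Main.v *)
(* Apply the property to f = g = T, where T acts on X = B^N (B = 2 or N), regarded as X * X.  For a
   sequence q = o^n i ... with n > 0, the point r = (i^w, q) is T^n s with s outside the image of T,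
   and neg_side (T^a s) holds iff a < n.  The bijection h maps T^a s to T^b s with a + b odd, so h
   and its inverse, used alternately, pair off the indices.  The number of pairs that cross n has
   the parity of n.  The orbit of r converges to a fixed point of T, which h fixes, so by Ishihara's
   tricks (with Markov's principle) either LPO holds or there are no crossings beyond some d; in the
   latter case the parity of n is read off from d values of h and its inverse.  Apply this to the
   codes o p and o o p of a binary sequence p: the parities differ if p has a 1, and agree if
   p = 0^w, hence whether p = 0^w is decidable.

   Derivations are obtained by reflection: the argument is carried out on Rocq's own nat, bool and
   Prop, with function extensionality and unique choice as hypotheses; Ltac quotes the proof
   terms, and the verified checker [infer] turns the quotations into derivations in [prv]. *)

Require Import Defs.
From Stdlib Require Import List Bool Eqdep_dec.
Import ListNotations.
Local Open Scope hol_scope.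
Set Implicit Arguments.
Unset Strict Implicit.

(** * Renaming and substitution *)

Lemma rup_sup G D (r : forall s, var G s -> tm D s) E (q : forall s, var E s -> var G s) t s (v : var (t :: E) s) :
  sup r (rup q v) = sup (fun s v => r s (q s v)) v.
Proof.
  revert r q.
  (* Case analysis on a variable of a nonempty context: the return clause computes on the context
     and sends the impossible empty one to [unit], so no axiom on dependent equality enters. *)
  refine (match v in var G' s' return match G' with
    | [] => fun _ => unit
    | t' :: E' => fun v => forall r (q : forall s, var E' s -> var G s),
        sup r (rup q v) = sup (fun s v => r s (q s v)) v end v with
    | vz => _ | vs w => _ end); reflexivity.
Qed.

Lemma sup_ext G D (r r' : forall s, var G s -> tm D s) (E : forall s v, r s v = r' s v) t s (v : var (t :: G) s) :
  sup r v = sup r' v.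
Proof.
  revert r r' E.
  refine (match v in var G' s' return match G' with
    | [] => fun _ => unit
    | t' :: E' => fun v => forall (r r' : forall s, var E' s -> tm D s),
       (forall s v, r s v = r' s v) -> sup r v = sup r' v end v with
    | vz => _ | vs w => _ end); intros r r' E; [reflexivity|].
  cbn. now rewrite E.
Qed.

Lemma sup_id G t s (v : var (t :: G) s) : sup (fun s (v : var G s) => Var v) v = Var v.
Proof.
  refine (match v in var G' s' return match G' with
    | [] => fun _ => unit
    | t' :: E' => fun v => sup (fun s (v : var E' s) => Var v) v = Var v end v with
    | vz => _ | vs w => _ end); reflexivity.
Qed.

Lemma sub_ext G s (a : tm G s) : forall D (r r' : forall s, var G s -> tm D s),
  (forall s v, r s v = r' s v) -> sub r a = sub r' a.
Proof.
  induction a; intros D r r' E; cbn; f_equal; eauto; apply IHa; intros; now apply sup_ext.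
Qed.

Lemma sub_ren G s (a : tm G s) : forall E (q : forall s, var G s -> var E s) D (r : forall s, var E s -> tm D s),
  sub r (ren q a) = sub (fun s v => r s (q s v)) a.
Proof.
  induction a; intros E q D r; cbn; f_equal; eauto;
  rewrite IHa; apply sub_ext; intros; apply rup_sup.
Qed.

Lemma sub_id G s (a : tm G s) : forall r, (forall s v, r s v = Var v) -> sub r a = a.
Proof.
  induction a; intros r E; cbn; f_equal; eauto; apply IHa; intros u v;
  rewrite (sup_ext E); apply sup_id.
Qed.

Lemma inst_wk G s t (a : tm G s) (b : tm G t) : inst a (wk b) = b.
Proof. unfold inst, wk. rewrite sub_ren. now apply sub_id. Qed.

Lemma scons_rup G t s (v : var (t :: G) s) :
  scons (P := tm (t :: G)) (Var vz) (fun s v => Var v) (rup (fun s v => vs v) v) = Var v.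
Proof.
  refine (match v in var G' s' return match G' return var G' s' -> Type with
    | [] => fun _ => unit
    | t' :: E' => fun v => scons (P := tm (t' :: E')) (Var vz) (fun s v => Var v) (rup (fun s v => vs v) v) = Var v end v with
    | vz => _ | vs w => _ end); reflexivity.
Qed.

Lemma inst_rup G s t (b : tm (s :: G) t) :
  inst (Var vz) (ren (rup (fun _ v => vs v) (t := s)) b) = b.
Proof.
  unfold inst. rewrite sub_ren. apply sub_id. intros u v. apply scons_rup.
Qed.

(** * Equality and congruence in the calculus *)

Lemma eq_mp G (H : list (tm G Om)) p q : prv H (p == q) -> prv H p -> prv H q.
Proof. intros E P. exact (pSubst (p := Var vz) E P). Qed.

Lemma eq_sym' G (H : list (tm G Om)) s (a b : tm G s) : prv H (a == b) -> prv H (b == a).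
Proof.
  intros E. pose proof (pSubst (p := Var vz == wk a) E) as P. cbn in P.
  change (sub (scons (P:=tm G) ?x _) (wk a)) with (inst x (wk a)) in P.
  rewrite !inst_wk in P. apply P, pRefl.
Qed.

Lemma eq_trans' G (H : list (tm G Om)) s (a b c : tm G s) :
  prv H (a == b) -> prv H (b == c) -> prv H (a == c).
Proof.
  intros E F. pose proof (pSubst (p := wk a == Var vz) F) as P. cbn in P.
  change (sub (scons (P:=tm G) ?x _) (wk a)) with (inst x (wk a)) in P.
  rewrite !inst_wk in P. auto.
Qed.

Lemma cong G (H : list (tm G Om)) s t (c : tm (s :: G) t) (a b : tm G s) :
  prv H (a == b) -> prv H (inst a c == inst b c).
Proof.
  (* Weakening freezes the left side of [wk (inst a c) == c]: the predicate holds at [a] by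
     reflexivity and is transported to [b]. *)
  intros E. pose proof (pSubst (p := wk (inst a c) == c) E) as P. cbn in P.
  change (sub (scons (P:=tm G) ?x _) ?y) with (inst x y) in P.
  rewrite !inst_wk in P. apply P, pRefl.
Qed.


Tactic Notation "cong_by" uconstr(c) constr(E) :=
  let P := fresh in
  pose proof (cong c E) as P; unfold inst in P; cbn [sub] in P;
  repeat match type of P with context [sub (scons ?x (fun s v => Var v)) (wk ?y)] =>
    change (sub (scons x (fun s v => Var v)) (wk y)) with (inst x (wk y)) in P end;
  rewrite ?inst_wk in P; exact P.

Lemma cong_app G (H : list (tm G Om)) s t (f f' : tm G (s ~> t)) a a' :
  prv H (f == f') -> prv H (a == a') -> prv H (f @ a == f' @ a').
Proof.
  intros E F. apply eq_trans' with (f' @ a).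
  - cong_by (Var vz @ wk a) E.
  - cong_by (wk f' @ Var vz) F.
Qed.

Lemma cong_eq G (H : list (tm G Om)) s (a a' b b' : tm G s) :
  prv H (a == a') -> prv H (b == b') -> prv H ((a == b) == (a' == b')).
Proof.
  intros E F. apply eq_trans' with (a' == b).
  - cong_by (Var vz == wk b) E.
  - cong_by (wk a' == Var vz) F.
Qed.

Lemma cong_and G (H : list (tm G Om)) (a a' b b' : tm G Om) :
  prv H (a == a') -> prv H (b == b') -> prv H ((a //\\ b) == (a' //\\ b')).
Proof.
  intros E F. apply eq_trans' with (a' //\\ b).
  - cong_by (Var vz //\\ wk b) E.
  - cong_by (wk a' //\\ Var vz) F.
Qed.

Lemma cong_or G (H : list (tm G Om)) (a a' b b' : tm G Om) :
  prv H (a == a') -> prv H (b == b') -> prv H ((a \\// b) == (a' \\// b')).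
Proof.
  intros E F. apply eq_trans' with (a' \\// b).
  - cong_by (Var vz \\// wk b) E.
  - cong_by (wk a' \\// Var vz) F.
Qed.

Lemma cong_imp G (H : list (tm G Om)) (a a' b b' : tm G Om) :
  prv H (a == a') -> prv H (b == b') -> prv H ((a ==> b) == (a' ==> b')).
Proof.
  intros E F. apply eq_trans' with (a' ==> b).
  - cong_by (Var vz ==> wk b) E.
  - cong_by (wk a' ==> Var vz) F.
Qed.

Lemma cong_succ G (H : list (tm G Om)) (a a' : tm G Nn) :
  prv H (a == a') -> prv H (Succ a == Succ a').
Proof. intros E. cong_by (Succ (Var vz : tm (Nn :: G) Nn)) E. Qed.

Lemma cong_rec G (H : list (tm G Om)) s (a a' : tm G s) f f' n n' :
  prv H (a == a') -> prv H (f == f') -> prv H (n == n') ->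
  prv H (Rec a f n == Rec a' f' n').
Proof.
  intros E F N. apply eq_trans' with (Rec a' f n); [|apply eq_trans' with (Rec a' f' n)].
  - cong_by (Rec (Var vz) (wk f) (wk n)) E.
  - cong_by (Rec (wk a') (Var vz) (wk n)) F.
  - cong_by (Rec (wk a') (wk f') (Var vz)) N.
Qed.

Lemma cong_ite G (H : list (tm G Om)) s c c' (a a' b b' : tm G s) :
  prv H (c == c') -> prv H (a == a') -> prv H (b == b') ->
  prv H (Ite c a b == Ite c' a' b').
Proof.
  intros E F N. apply eq_trans' with (Ite c' a b); [|apply eq_trans' with (Ite c' a' b)].
  - cong_by (Ite (Var vz) (wk a) (wk b)) E.
  - cong_by (Ite (wk c') (Var vz) (wk b)) F.
  - cong_by (Ite (wk c') (wk a') (Var vz)) N.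
Qed.

Lemma cong_lam G (H : list (tm G Om)) s t (a a' : tm (s :: G) t) :
  prv (map (@wk G Om s) H) (a == a') -> prv H (Lam s a == Lam s a').
Proof.
  intros E. apply pFunExt, pAllI. unfold wk at 2 3; cbn [ren].
  pose proof (pBeta (map (@wk G Om s) H) (ren (rup (fun _ v => vs v) (t := s)) a) (Var vz)) as B.
  pose proof (pBeta (map (@wk G Om s) H) (ren (rup (fun _ v => vs v) (t := s)) a') (Var vz)) as B'.
  rewrite inst_rup in B, B'.
  eapply eq_trans'; [exact B|]. eapply eq_trans'; [exact E|]. now apply eq_sym'.
Qed.

Lemma var_all G (H : list (tm G Om)) s (p : tm (s :: G) Om) :
  In (All s p) H -> prv (map (@wk G Om s) H) p.
Proof.
  intros I. assert (P : prv (map (@wk G Om s) H) (wk (All s p))) by (apply pAx; now apply in_map).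
  unfold wk at 2 in P; cbn [ren] in P. apply pAllE with (a := Var vz) in P.
  now rewrite inst_rup in P.
Qed.

(** The premise is asked for under every list of hypotheses because it is used below the binder,
    where the quantified formula itself has joined the weakened hypotheses. *)
Lemma cong_all G (H : list (tm G Om)) s (a a' : tm (s :: G) Om) :
  (forall H', prv H' (a == a')) -> prv H (All s a == All s a').
Proof.
  intros E. apply pPropExt; apply pImpI, pAllI.
  - eapply eq_mp; [apply E|]. apply var_all; now left.
  - eapply eq_mp; [apply eq_sym', E|]. apply var_all; now left.
Qed.

Lemma ex_mono G (H : list (tm G Om)) s (a a' : tm (s :: G) Om) :
  (forall H', prv H' (a == a')) -> In (Ex s a) H -> prv H (Ex s a').
Proof.
  intros E I. apply pExE with s a; [now apply pAx|].
  unfold wk at 2; cbn [ren]. apply pExI with (Var vz). rewrite inst_rup.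
  eapply eq_mp; [apply E|]. apply pAx; now left.
Qed.

Lemma cong_ex G (H : list (tm G Om)) s (a a' : tm (s :: G) Om) :
  (forall H', prv H' (a == a')) -> prv H (Ex s a == Ex s a').
Proof.
  intros E. apply pPropExt; apply pImpI.
  - apply ex_mono with a; [easy|now left].
  - apply ex_mono with a'; [|now left]. intros; now apply eq_sym'.
Qed.

(** * Normalisation with fuel *)

Definition beta G s t (f : tm G (s ~> t)) (a : tm G s) : option (tm G t) :=
  match f in tm G' u return match u with
    | Arr s t => tm G' s -> option (tm G' t)
    | _ => unit end with
  | Lam s b => fun a => Some (inst a b)
  | @App _ _ u _ _ | @Rec _ u _ _ _ | @Ite _ u _ _ _ | @Var _ u _ =>
      match u with Arr _ _ => fun _ => None | _ => tt end
  | _ => tt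
  end a.

Definition case_nat G (n : tm G Nn) : option (option (tm G Nn)) :=
  match n in tm G' _ return option (option (tm G' Nn)) with
  | Zero => Some None
  | Succ m => Some (Some m)
  | _ => None
  end.

Definition case_two G (n : tm G Two) : option bool :=
  match n with TT => Some true | FF => Some false | _ => None end.

(** The traversal [go] is structural; only the result of a beta step or of a recursor step at a
    successor is normalised again, with one unit of fuel less. When fuel runs out the term is
    returned as it is, so soundness needs no termination argument. *)
Fixpoint norm (k : nat) : forall G s, tm G s -> tm G s :=
  match k with
  | 0 => fun _ _ a => a
  | S k => fix go G s (a : tm G s) {struct a} : tm G s :=
    match a with
    | Var v => Var v
    | Lam s b => Lam s (go _ _ b)
    | App f a =>
        let f := go _ _ f in let a := go _ _ a in
        match beta f a with Some b => norm k b | None => App f a end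
    | Eq a b => Eq (go _ _ a) (go _ _ b)
    | Bot => Bot
    | And a b => And (go _ _ a) (go _ _ b)
    | Or a b => Or (go _ _ a) (go _ _ b)
    | Imp a b => Imp (go _ _ a) (go _ _ b)
    | All s b => All s (go _ _ b)
    | Ex s b => Ex s (go _ _ b)
    | Zero => Zero
    | Succ n => Succ (go _ _ n)
    | Rec a f n =>
        let a := go _ _ a in let f := go _ _ f in let n := go _ _ n in
        match case_nat n with
        | Some None => a
        | Some (Some m) => norm k (f @ m @ Rec a f m)
        | None => Rec a f n
        end
    | FF => FF
    | TT => TT
    | Ite c a b =>
        let c := go _ _ c in
        match case_two c with
        | Some true => go _ _ a
        | Some false => go _ _ b
        | None => Ite c (go _ _ a) (go _ _ b)
        end
    end
  end.

Lemma beta_sound G (H : list (tm G Om)) s t (f : tm G (s ~> t)) a b :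
  beta f a = Some b -> prv H (f @ a == b).
Proof.
  revert H a b.
  refine (match f as f in tm G' u return match u return tm G' u -> Prop with
    | Arr s t => fun f => forall H a b, beta f a = Some b -> prv H (f @ a == b)
    | _ => fun _ => True end f with
  | Lam s b => _ | @App _ _ u _ _ => _ | @Rec _ u _ _ _ => _ | @Ite _ u _ _ _ => _ | @Var _ u _ => _
  | _ => I end).
  1, 3, 4, 5: destruct u; try exact I; discriminate.
  intros H a c [= <-]. apply pBeta.
Qed.

Lemma case_nat_sound G (n : tm G Nn) :
  match case_nat n with
  | Some None => n = Zero | Some (Some m) => n = Succ m | None => True end.
Proof.
  refine (match n as n in tm G' u return match u return tm G' u -> Prop with
    | Nn => fun n => match case_nat n with
       | Some None => n = Zero | Some (Some m) => n = Succ m | None => True end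
    | _ => fun _ => True end n with
  | @App _ _ u _ _ => _ | @Rec _ u _ _ _ => _ | @Ite _ u _ _ _ => _ | @Var _ u _ => _ | Zero => eq_refl
  | Succ n => eq_refl
  | _ => I end); destruct u; exact I.
Qed.

Lemma case_two_sound G (n : tm G Two) :
  match case_two n with
  | Some true => n = TT | Some false => n = FF | None => True end.
Proof.
  refine (match n as n in tm G' u return match u return tm G' u -> Prop with
    | Two => fun n => match case_two n with
       | Some true => n = TT | Some false => n = FF | None => True end
    | _ => fun _ => True end n with
  | @App _ _ u _ _ => _ | @Rec _ u _ _ _ => _ | @Ite _ u _ _ _ => _ | @Var _ u _ => _
  | TT => eq_refl | FF => eq_refl
  | _ => I end); destruct u; exact I.
Qed.

Lemma norm_sound k : forall G s (a : tm G s) H, prv H (a == norm k a).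
Proof.
  induction k as [|k IH]; [intros; apply pRefl|].
  induction a; intros H; try apply pRefl.
  - apply cong_lam, IHa.
  - set (f' := norm (S k) a1). set (a' := norm (S k) a2).
    eapply eq_trans'; [apply cong_app; [apply IHa1|apply IHa2]|].
    change (prv H (f' @ a' == match beta f' a' with Some b => norm k b | None => f' @ a' end)).
    destruct (beta f' a') eqn:E; [|apply pRefl].
    eapply eq_trans'; [apply beta_sound, E|apply IH].
  - now apply cong_eq.
  - now apply cong_and.
  - now apply cong_or.
  - now apply cong_imp.
  - now apply cong_all.
  - now apply cong_ex.
  - now apply cong_succ.
  - set (a' := norm (S k) a1). set (f' := norm (S k) a2). set (n' := norm (S k) a3).
    eapply eq_trans'; [apply cong_rec; [apply IHa1|apply IHa2|apply IHa3]|].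
    change (prv H (Rec a' f' n' == match case_nat n' with Some None => a'
      | Some (Some m) => norm k (f' @ m @ Rec a' f' m) | None => Rec a' f' n' end)).
    pose proof (case_nat_sound n') as C.
    destruct (case_nat n') as [[m|]|]; [| |apply pRefl]; rewrite C.
    + eapply eq_trans'; [apply pRecSucc|apply IH].
    + apply pRecZero.
  - set (c' := norm (S k) a1). set (a' := norm (S k) a2). set (b' := norm (S k) a3).
    eapply eq_trans'; [apply cong_ite; [apply IHa1|apply IHa2|apply IHa3]|].
    change (prv H (Ite c' a' b' == match case_two c' with Some true => a'
      | Some false => b' | None => Ite c' a' b' end)).
    pose proof (case_two_sound c') as C.
    destruct (case_two c') as [[]|]; [| |apply pRefl]; rewrite C.
    + apply pIteTrue.
    + apply pIteFalse.
Qed.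

(** * Untyped terms and comparison up to normalisation *)

Definition ty_dec (s t : ty) : {s = t} + {s <> t}.
Proof. decide equality. Defined.

(** Without typing indices, syntactic equality is decidable by [decide equality], and tactics can
    write quotations without computing contexts; [elab] restores the types. *)
Inductive raw : Type :=
| rVar (n : nat)
| rLam (s : ty) (b : raw)
| rApp (f a : raw)
| rEq (a b : raw)
| rBot
| rAnd (p q : raw)
| rOr (p q : raw)
| rImp (p q : raw)
| rAll (s : ty) (p : raw)
| rEx (s : ty) (p : raw)
| rZero
| rSucc (n : raw)
| rRec (a f n : raw)
| rFF
| rTT
| rIte (c a b : raw).

Definition raw_dec (a b : raw) : {a = b} + {a <> b}.
Proof. decide equality; (apply ty_dec || apply PeanoNat.Nat.eq_dec). Defined.

Fixpoint level G s (v : var G s) : nat :=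
  match v with vz => 0 | vs v => S (level v) end.

Fixpoint er G s (a : tm G s) : raw :=
  match a with
  | Var v => rVar (level v)
  | Lam s b => rLam s (er b)
  | App f a => rApp (er f) (er a)
  | Eq a b => rEq (er a) (er b)
  | Bot => rBot
  | And a b => rAnd (er a) (er b)
  | Or a b => rOr (er a) (er b)
  | Imp a b => rImp (er a) (er b)
  | All s b => rAll s (er b)
  | Ex s b => rEx s (er b)
  | Zero => rZero
  | Succ n => rSucc (er n)
  | Rec a f n => rRec (er a) (er f) (er n)
  | FF => rFF
  | TT => rTT
  | Ite c a b => rIte (er c) (er a) (er b)
  end.

Notation "'let?' x := e 'in' k" := (match e with Some x => k | None => None end)
  (at level 200, x pattern, right associativity).

Definition at_ty G t (a : option {s & tm G s}) : option (tm G t) :=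
  let? existT _ s a := a in
  match ty_dec s t with left e => Some (eq_rect s (tm G) a t e) | right _ => None end.

Fixpoint nth_var G n : option {s & var G s} :=
  match G with
  | [] => None
  | s :: G => match n with
    | 0 => Some (existT _ s vz)
    | S n => let? existT _ t v := nth_var G n in Some (existT _ t (vs v))
    end
  end.

Fixpoint elab G (a : raw) : option {s & tm G s} :=
  match a with
  | rVar n => let? existT _ s v := nth_var G n in Some (existT _ s (Var v))
  | rLam s b => let? existT _ t b := elab (s :: G) b in Some (existT _ _ (Lam s b))
  | rApp f a =>
      let? existT _ u f := elab G f in
      match u return tm G u -> _ with
      | Arr s t => fun f => let? a := at_ty s (elab G a) in Some (existT _ t (App f a))
      | _ => fun _ => None
      end f
  | rEq a b => let? existT _ s a := elab G a in
      let? b := at_ty s (elab G b) in Some (existT _ _ (Eq a b))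
  | rBot => Some (existT _ _ Bot)
  | rAnd a b => let? a := at_ty Om (elab G a) in
      let? b := at_ty Om (elab G b) in Some (existT _ _ (And a b))
  | rOr a b => let? a := at_ty Om (elab G a) in
      let? b := at_ty Om (elab G b) in Some (existT _ _ (Or a b))
  | rImp a b => let? a := at_ty Om (elab G a) in
      let? b := at_ty Om (elab G b) in Some (existT _ _ (Imp a b))
  | rAll s b => let? b := at_ty Om (elab (s :: G) b) in Some (existT _ _ (All s b))
  | rEx s b => let? b := at_ty Om (elab (s :: G) b) in Some (existT _ _ (Ex s b))
  | rZero => Some (existT _ _ Zero)
  | rSucc n => let? n := at_ty Nn (elab G n) in Some (existT _ _ (Succ n))
  | rRec a f n => let? existT _ s a := elab G a in
      let? f := at_ty (Nn ~> s ~> s) (elab G f) in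
      let? n := at_ty Nn (elab G n) in Some (existT _ _ (Rec a f n))
  | rFF => Some (existT _ _ FF)
  | rTT => Some (existT _ _ TT)
  | rIte c a b => let? c := at_ty Two (elab G c) in
      let? existT _ s a := elab G a in
      let? b := at_ty s (elab G b) in Some (existT _ _ (Ite c a b))
  end.

Lemma at_ty_refl G s (a : tm G s) : at_ty s (Some (existT _ s a)) = Some a.
Proof.
  cbn. destruct (ty_dec s s) as [e|n]; [|now destruct n].
  now rewrite (UIP_dec ty_dec e eq_refl).
Qed.

Lemma nth_var_level G s (v : var G s) : nth_var G (level v) = Some (existT _ s v).
Proof. induction v; cbn; [easy|]. now rewrite IHv. Qed.

Lemma elab_er G s (a : tm G s) : elab G (er a) = Some (existT _ s a).
Proof.
  induction a; cbn [er elab]; rewrite ?nth_var_level;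
  repeat match goal with E : elab _ _ = _ |- _ => rewrite E; clear E end;
  rewrite ?at_ty_refl; reflexivity.
Qed.

(** Elaboration is a left inverse of erasure; the equality of dependent pairs it yields gives one of
    terms because types have decidable equality. *)
Lemma er_inj G s (a b : tm G s) : er a = er b -> a = b.
Proof.
  intros E. pose proof (elab_er a) as A. rewrite E, elab_er in A.
  injection A as A. symmetry. revert A. apply inj_pair2_eq_dec, ty_dec.
Qed.

(** Every value is sound; it only has to be large enough for the comparisons made in the script. *)
Definition fuel := 200.

Definition same G s (a b : tm G s) : bool :=
  if raw_dec (er a) (er b) then true
  else if raw_dec (er (norm fuel a)) (er (norm fuel b)) then true else false.

Lemma same_eq G H s (a b : tm G s) : same a b = true -> prv H (a == b).
Proof.
  unfold same. destruct (raw_dec (er a) (er b)) as [E|_].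
  { rewrite (er_inj E). intros _. apply pRefl. }
  destruct (raw_dec _ _) as [E|_]; [|discriminate]. apply er_inj in E.
  intros _. eapply eq_trans'; [apply norm_sound|].
  rewrite E. apply eq_sym', norm_sound.
Qed.

Lemma same_sound G H (a b : tm G Om) : same a b = true -> prv H a -> prv H b.
Proof. intros E. apply eq_mp. now apply same_eq. Qed.

(** * The proof checker *)

Definition view_imp G s (p : tm G s) : option (tm G Om * tm G Om) :=
  match p with Imp a b => Some (a, b) | _ => None end.
Definition view_and G s (p : tm G s) : option (tm G Om * tm G Om) :=
  match p with And a b => Some (a, b) | _ => None end.
Definition view_or G s (p : tm G s) : option (tm G Om * tm G Om) :=
  match p with Or a b => Some (a, b) | _ => None end.
Definition view_all G s (p : tm G s) : option {s & tm (s :: G) Om} :=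
  match p with All s p => Some (existT _ s p) | _ => None end.
Definition view_ex G s (p : tm G s) : option {s & tm (s :: G) Om} :=
  match p with Ex s p => Some (existT _ s p) | _ => None end.
Definition view_eq G s (p : tm G s) : option {s & (tm G s * tm G s)%type} :=
  match p with Eq a b => Some (existT _ _ (a, b)) | _ => None end.
Definition view_bot G s (p : tm G s) : option unit :=
  match p with Bot => Some tt | _ => None end.

(** After passing to erasures the goal no longer depends on the index [Om] of [p], so [destruct] can
    generalise it. *)
Ltac view_tac := intros E; apply er_inj; revert E;
  match goal with |- ?v ?p = _ -> er ?p = er ?q =>
    destruct p; cbn [view_imp view_and view_or view_all view_ex view_eq view_bot er];
    intros [= <-] || discriminate; reflexivity end.

Lemma view_imp_sound G (p : tm G Om) z : view_imp p = Some z -> p = Imp (fst z) (snd z).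
Proof. view_tac. Qed.
Lemma view_and_sound G (p : tm G Om) z : view_and p = Some z -> p = And (fst z) (snd z).
Proof. view_tac. Qed.
Lemma view_or_sound G (p : tm G Om) z : view_or p = Some z -> p = Or (fst z) (snd z).
Proof. view_tac. Qed.
Lemma view_all_sound G (p : tm G Om) z : view_all p = Some z -> p = All (projT1 z) (projT2 z).
Proof. view_tac. Qed.
Lemma view_ex_sound G (p : tm G Om) z : view_ex p = Some z -> p = Ex (projT1 z) (projT2 z).
Proof. view_tac. Qed.
Lemma view_eq_sound G (p : tm G Om) z :
  view_eq p = Some z -> p = Eq (fst (projT2 z)) (snd (projT2 z)).
Proof. view_tac. Qed.
Lemma view_bot_sound G (p : tm G Om) z : view_bot p = Some z -> p = Bot.
Proof. view_tac. Qed.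

(** The main connective may appear only after normalisation, for instance when a formula is a
    predicate applied to an argument. *)
Definition viewing G A (view : tm G Om -> option A) (p : tm G Om) : option A :=
  match view p with Some x => Some x | None => view (norm fuel p) end.

Lemma viewing_sound G A (view : tm G Om -> option A) (q : A -> tm G Om) :
  (forall p z, view p = Some z -> p = q z) ->
  forall H p z, viewing view p = Some z -> prv H p -> prv H (q z).
Proof.
  intros V H p z. unfold viewing. destruct (view p) eqn:E.
  - intros [= ->]. now rewrite (V _ _ E).
  - intros F P. rewrite <- (V _ _ F). eapply eq_mp; [apply norm_sound|exact P].
Qed.

(* [PHyp] counts hypotheses from the most recent one, [PLem] from the oldest one, so that the
   lemmas proved first keep their number under further hypotheses. *)
Inductive pf : Type :=
| PHyp (n : nat)
| PLem (n : nat)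
| PLam (p : raw) (b : pf)
| PGen (s : ty) (b : pf)
| PApp (f a : pf)
| PInst (f : pf) (a : raw)
| PConj (a b : pf)
| PAndE (f h : pf)
| PInl (q : raw) (a : pf)
| PInr (p : raw) (b : pf)
| POrE (f g h : pf)
| PExI (s : ty) (p x : raw) (a : pf)
| PExE (r : raw) (f h : pf)
| PBotE (r : raw) (h : pf)
| PRefl (a : raw)
| PSubst (p : raw) (a e : pf)
| PInd (p : raw) (a b : pf) (n : raw)
| PCases (p : raw) (a b : pf) (c : raw).

Definition guard (b : bool) A (x : A) : option A := if b then Some x else None.

(** The proved formula is recomputed from the leaves. Formulas that must agree are compared by
    [same], which stands in for the conversion that Rocq applied silently in the quoted term. *)
Fixpoint infer G (H : list (tm G Om)) (t : pf) : option (tm G Om) :=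
  match t with
  | PHyp n => nth_error H n
  | PLem n => nth_error H (length H - S n)
  | PLam p b => let? p := at_ty Om (elab G p) in
      let? q := infer (p :: H) b in Some (Imp p q)
  | PGen s b => let? q := infer (map (@wk G Om s) H) b in Some (All s q)
  | PApp f a => let? f := infer H f in let? pq := viewing (@view_imp G Om) f in
      let? p := infer H a in guard (same p (fst pq)) (snd pq)
  | PInst f a => let? f := infer H f in let? p := viewing (@view_all G Om) f in
      let? a := at_ty (projT1 p) (elab G a) in Some (inst a (projT2 p))
  | PConj a b => let? p := infer H a in let? q := infer H b in Some (And p q)
  | PAndE f h => let? h := infer H h in let? pq := viewing (@view_and G Om) h in
      let? f := infer H f in let? pf := viewing (@view_imp G Om) f in
      let? qr := viewing (@view_imp G Om) (snd pf) in
      guard (andb (same (fst pq) (fst pf)) (same (snd pq) (fst qr))) (snd qr)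
  | PInl q a => let? p := infer H a in let? q := at_ty Om (elab G q) in Some (Or p q)
  | PInr p b => let? q := infer H b in let? p := at_ty Om (elab G p) in Some (Or p q)
  | POrE f g h => let? h := infer H h in let? pq := viewing (@view_or G Om) h in
      let? f := infer H f in let? pr := viewing (@view_imp G Om) f in
      let? g := infer H g in let? qr := viewing (@view_imp G Om) g in
      guard (andb (same (fst pq) (fst pr)) (andb (same (snd pq) (fst qr)) (same (snd qr) (snd pr))))
        (snd pr)
  | PExI s p x a => let? p := at_ty Om (elab (s :: G) p) in
      let? x := at_ty s (elab G x) in
      let? q := infer H a in guard (same q (inst x p)) (Ex s p)
  | PExE r f h => let? r := at_ty Om (elab G r) in
      let? h := infer H h in let? p := viewing (@view_ex G Om) h in
      let? f := infer H f in
      guard (same f (All (projT1 p) (projT2 p ==> wk r))) r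
  | PBotE r h => let? r := at_ty Om (elab G r) in
      let? h := infer H h in let? _ := viewing (@view_bot G Om) h in Some r
  | PRefl a => let? a := elab G a in Some (Eq (projT2 a) (projT2 a))
  | PSubst p a e => let? e := infer H e in let? ab := viewing (@view_eq G Om) e in
      let? p := at_ty (projT1 ab ~> Om) (elab G p) in
      let? q := infer H a in guard (same q (p @ fst (projT2 ab))) (p @ snd (projT2 ab))
  | PInd p a b n => let? p := at_ty (Nn ~> Om) (elab G p) in
      let? n := at_ty Nn (elab G n) in
      let? a := infer H a in let? b := infer H b in
      guard (andb (same a (p @ Zero)) (same b (All Nn (wk p @ #0 ==> wk p @ Succ #0)))) (p @ n)
  | PCases p a b c => let? p := at_ty (Two ~> Om) (elab G p) in
      let? c := at_ty Two (elab G c) in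
      let? a := infer H a in let? b := infer H b in
      guard (andb (same a (p @ TT)) (same b (p @ FF))) (p @ c)
  end.

Lemma or_elim G (H : list (tm G Om)) p q r :
  prv H (p \\// q) -> prv H (p ==> r) -> prv H (q ==> r) -> prv H r.
Proof.
  (* The rule [pOrE] changes the hypotheses of its minor premises. Deriving the elimination as an
     implication first keeps all premises under the same [H], so no weakening lemma for derivations
     is needed. *)
  assert (T : prv H ((p \\// q) ==> (p ==> r) ==> (q ==> r) ==> r)).
  { do 3 apply pImpI. apply pOrE with p q; [apply pAx; cbn; tauto| |].
    - apply pImpE with p; apply pAx; cbn; tauto.
    - apply pImpE with q; apply pAx; cbn; tauto. }
  intros P Q R. exact (pImpE (pImpE (pImpE T P) Q) R).
Qed.

Lemma ex_elim G (H : list (tm G Om)) s (p : tm (s :: G) Om) r :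
  prv H (Ex s p) -> prv H (All s (p ==> wk r)) -> prv H r.
Proof.
  assert (T : prv H (Ex s p ==> All s (p ==> wk r) ==> r)).
  { do 2 apply pImpI. apply pExE with s p; [apply pAx; cbn; tauto|].
    apply pImpE with p; [|apply pAx; now left]. cbn [map].
    assert (P : prv (p :: wk (All s (p ==> wk r)) :: wk (Ex s p) :: map (@wk G Om s) H)
      (wk (All s (p ==> wk r)))) by (apply pAx; cbn; tauto).
    apply (pAllE (p := ren (rup (fun _ v => vs v) (t := s)) (p ==> wk r)) (Var vz)) in P.
    now rewrite inst_rup in P. }
  intros P Q. exact (pImpE (pImpE T P) Q).
Qed.

Lemma infer_sound t : forall G (H : list (tm G Om)) p, infer H t = Some p -> prv H p.
Proof.
  induction t; intros G H r0; cbn [infer]; unfold guard;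
  repeat match goal with
  | |- (let? x := ?e in _) = _ -> _ => destruct e as [?|] eqn:?; [|discriminate]
  | |- (if ?e then _ else _) = _ -> _ => destruct e eqn:?; [|discriminate]
  | E : andb _ _ = true |- _ => apply andb_prop in E; destruct E
  end;
  repeat match goal with
  | IH : forall G H p, @infer G H ?t = Some p -> _, E : infer _ ?t = Some _ |- _ => apply IH in E; clear IH
  end.
  all: repeat match goal with
  | E : viewing _ _ = Some _, P : @prv ?G _ _ |- _ =>
      first [apply (viewing_sound (@view_imp_sound G) E) in P
            |apply (viewing_sound (@view_and_sound G) E) in P
            |apply (viewing_sound (@view_or_sound G) E) in P
            |apply (viewing_sound (@view_all_sound G) E) in P
            |apply (viewing_sound (@view_ex_sound G) E) in P
            |apply (viewing_sound (@view_eq_sound G) E) in P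
            |apply (viewing_sound (@view_bot_sound G) E) in P]; clear E
  end.
  all: repeat match goal with
  | E : same ?p ?q = true, P : prv ?H ?p |- _ => apply (same_sound E) in P; clear E
  end.
  all: try (let E := fresh in intros E; injection E as E; subst r0).
  - intros E. eapply pAx, nth_error_In, E.
  - intros E. eapply pAx, nth_error_In, E.
  - now apply pImpI.
  - now apply pAllI.
  - eapply pImpE; eassumption.
  - now apply pAllE.
  - now apply pAndI.
  - repeat match goal with E : same _ _ = true |- _ => revert E end.
    intros E F. pose proof (fun P => viewing_sound (@view_imp_sound G) (H := H) Heqo3 P) as V.
    apply pImpE with (fst p1); [|eapply same_sound; [exact F|now apply pAndE2 in Heqo]].
    apply V. apply pImpE with (fst p0); [easy|].
    eapply same_sound; [exact E|now apply pAndE1 in Heqo].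
  - now apply pOrI1.
  - now apply pOrI2.
  - repeat match goal with E : same _ _ = true |- _ => revert E end. intros E F R.
    apply or_elim with (fst p0) (fst p1); [|easy|].
    + eapply eq_mp; [|exact Heqo]. now apply cong_or; apply same_eq.
    + eapply eq_mp; [|exact Heqo3]. apply cong_imp; [apply pRefl|now apply same_eq].
  - eapply pExI; eassumption.
  - eapply ex_elim; eassumption.
  - now apply pBotE.
  - apply pRefl.
  - eapply eq_mp; [|eassumption]. apply cong_app; [apply pRefl|easy].
  - rewrite <- (inst_wk t0 t). apply (pAllE (p := wk t @ #0)). now apply pInd.
  - rewrite <- (inst_wk t0 t). apply (pAllE (p := wk t @ #0)). now apply pTwoCases.
Qed.

(** Each entry is a cut: once checked, its stated formula becomes a hypothesis for the later
    entries. *)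
Fixpoint check (H : list (tm [] Om)) (l : list (raw * pf)) : option (list (tm [] Om)) :=
  match l with
  | [] => Some H
  | (p, t) :: l =>
      let? p := at_ty Om (elab [] p) in
      let? q := infer H t in
      if same q p then check (p :: H) l else None
  end.

Lemma check_sound l : forall H H', check H l = Some H' -> forall p, prv H' p -> prv H p.
Proof.
  induction l as [|[p t] l IH]; intros H H'; cbn [check].
  - now intros [= ->].
  - destruct (at_ty Om (elab [] p)) as [p'|]; [|discriminate].
    destruct (infer H t) as [q|] eqn:E; [|discriminate].
    destruct (same q p') eqn:S; [|discriminate].
    intros C r R. apply (IH _ _ C) in R. apply pImpE with p'; [now apply pImpI|].
    eapply same_sound, infer_sound; eassumption.
Qed.

Definition proves (l : list (raw * pf)) (p : tm [] Om) : bool :=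
  match check [] l with Some (q :: _) => same q p | _ => false end.

Lemma proves_sound l p : proves l p = true -> prv [] p.
Proof.
  unfold proves. destruct (check [] l) as [[|q H]|] eqn:E; try discriminate.
  intros S. apply (check_sound E). eapply same_sound; [exact S|]. apply pAx; now left.
Qed.

(** * Quotation of terms and proofs *)

Ltac qty T :=
  lazymatch T with
  | Prop => constr:(Om)
  | bool => constr:(Two)
  | nat => constr:(Nn)
  | ?A -> ?B => let a := qty A in let b := qty B in constr:(Arr a b)
  end.

Ltac qvar x e :=
  lazymatch e with
  | (x, _) => constr:(O)
  | (_, ?e) => let n := qvar x e in constr:(S n)
  end.

Ltac head t := lazymatch t with ?f _ => head f | _ => t end.

Ltac unfold_head t := let h := head t in eval unfold h in t.

Ltac is_formula A := lazymatch type of A with Prop => idtac end.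

(* [te] and [he] list the term variables and the hypotheses in scope, innermost first, as nested
   pairs; [le] lists the lemmas already quoted with their numbers. *)
Ltac qtm te t :=
  lazymatch t with
  | fun x : ?A => @?b x =>
      let s := qty A in
      let y := fresh "y" in
      let r := constr:(fun y : A => ltac:(
        let b := eval cbv beta in (b y) in
        let te := constr:((y, te)) in
        let r := qtm te b in exact r)) in
      lazymatch r with fun _ => ?r => constr:(rLam s r) end
  | @eq _ ?a ?b => let a := qtm te a in let b := qtm te b in constr:(rEq a b)
  | and ?p ?q => let p := qtm te p in let q := qtm te q in constr:(rAnd p q)
  | or ?p ?q => let p := qtm te p in let q := qtm te q in constr:(rOr p q)
  | False => constr:(rBot)
  | ~ ?p => let p := qtm te p in constr:(rImp p rBot)
  | True => constr:(rImp rBot rBot)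
  | @ex ?A ?p => let r := qabs te A p in lazymatch r with (?s, ?r) => constr:(rEx s r) end
  (* A nondependent product is an implication if its domain is a formula, and a vacuous
     quantification otherwise. The nested [lazymatch goal] runs the test while a term is being
     built; its failure selects the second branch. *)
  | ?p -> ?q =>
      match goal with
      | _ => let _ := lazymatch goal with _ => is_formula p end in let p := qtm te p in let q := qtm te q in constr:(rImp p q)
      | _ => let r := qabs te p constr:(fun _ : p => q) in
          lazymatch r with (?s, ?r) => constr:(rAll s r) end
      end
  | forall x : ?A, @?p x => let r := qabs te A p in
      lazymatch r with (?s, ?r) => constr:(rAll s r) end
  | O => constr:(rZero)
  | S ?n => let n := qtm te n in constr:(rSucc n)
  | true => constr:(rTT)
  | false => constr:(rFF)
  | @nat_rect (fun _ => _) ?a ?f ?n =>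
      let a := qtm te a in let f := qtm te f in let n := qtm te n in constr:(rRec a f n)
  | if ?c then ?a else ?b =>
      let c := qtm te c in let a := qtm te a in let b := qtm te b in constr:(rIte c a b)
  | ?f ?a =>
      let h := head f in
      match goal with
      | _ => let _ := lazymatch goal with _ => is_const h end in let t := unfold_head t in qtm te t
      | _ => let f := qtm te f in let a := qtm te a in constr:(rApp f a)
      end
  | _ =>
      match goal with
      | _ => let _ := lazymatch goal with _ => is_var t end in let n := qvar t te in constr:(rVar n)
      | _ => let _ := lazymatch goal with _ => is_const t end in let t := eval unfold t in t in qtm te t
      end
  end
with qabs te A p :=
  let p := lazymatch p with fun _ => _ => p | _ => constr:(fun x : A => p x) end in
  let r := qtm te p in
  lazymatch r with rLam ?s ?r => constr:((s, r)) end.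

Ltac qlem t le :=
  lazymatch le with
  | ((?u, ?n), ?le) => match goal with _ => let _ := lazymatch goal with _ => constr_eq t u end in constr:(PLem n) | _ => qlem t le end
  end.

Ltac qpf le te he t :=
  lazymatch t with
  | fun x : ?A => @?b x =>
      lazymatch type of A with
      | Prop =>
        let p := qtm te A in
        let y := fresh "y" in
      let r := constr:(fun y : A => ltac:(
          let b := eval cbv beta in (b y) in
          let he := constr:((y, he)) in
          let r := qpf le te he b in exact r)) in
        lazymatch r with fun _ => ?r => constr:(PLam p r) end
      | _ =>
        let s := qty A in
        let y := fresh "y" in
      let r := constr:(fun y : A => ltac:(
          let b := eval cbv beta in (b y) in
          let te := constr:((y, te)) in
          let r := qpf le te he b in exact r)) in
        lazymatch r with fun _ => ?r => constr:(PGen s r) end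
      end
  (* A local proof becomes a cut; a local term is substituted away. *)
  | let x := ?v in @?b x =>
      let T := type of v in
      match goal with
      | _ => let _ := lazymatch goal with _ => is_formula T end in let t := constr:((fun x : T => b x) v) in
          let f := qpf le te he constr:(fun x : T => b x) in
          let a := qpf le te he v in constr:(PApp f a)
      | _ => let t := eval cbv zeta beta in (b v) in qpf le te he t
      end
  | @conj _ _ ?a ?b =>
      let a := qpf le te he a in let b := qpf le te he b in constr:(PConj a b)
  | @and_ind _ _ _ ?f ?h =>
      let f := qpf le te he f in let h := qpf le te he h in constr:(PAndE f h)
  | @proj1 ?p ?q ?h => qpf le te he constr:(@and_ind p q p (fun a b => a) h)
  | @proj2 ?p ?q ?h => qpf le te he constr:(@and_ind p q q (fun a b => b) h)
  | @or_introl _ ?q ?a => let q := qtm te q in let a := qpf le te he a in constr:(PInl q a)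
  | @or_intror ?p _ ?a => let p := qtm te p in let a := qpf le te he a in constr:(PInr p a)
  | @or_ind _ _ _ ?f ?g ?h =>
      let f := qpf le te he f in let g := qpf le te he g in let h := qpf le te he h in
      constr:(POrE f g h)
  | @ex_intro ?A ?p ?x ?a =>
      let p := qabs te A p in let x := qtm te x in let a := qpf le te he a in
      lazymatch p with (?s, ?p) => constr:(PExI s p x a) end
  | @ex_ind _ _ ?r ?f ?h =>
      let r := qtm te r in let f := qpf le te he f in let h := qpf le te he h in
      constr:(PExE r f h)
  | @False_ind ?r ?h =>
      let r := qtm te r in let h := qpf le te he h in constr:(PBotE r h)
  | I => constr:(PLam rBot (PHyp 0))
  | @eq_refl _ ?a => let a := qtm te a in constr:(PRefl a)
  | @eq_ind _ _ ?p ?a _ ?e =>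
      let p := qtm te p in let a := qpf le te he a in let e := qpf le te he e in
      constr:(PSubst p a e)
  | @eq_sym ?A ?x ?y ?e =>
      qpf le te he constr:(@eq_ind A x (fun z => z = x) eq_refl y e)
  | @eq_trans ?A ?x ?y ?z ?e ?f =>
      qpf le te he constr:(@eq_ind A y (fun w => x = w) e z f)
  | @f_equal ?A ?B ?f ?x ?y ?e =>
      qpf le te he constr:(@eq_ind A x (fun z => f x = f z) eq_refl y e)
  | @eq_ind_r ?A ?x ?p ?a ?y ?e =>
      qpf le te he constr:(@eq_ind A x p a y (eq_sym e))
  | nat_ind ?p ?a ?b ?n =>
      let p := qtm te p in let n := qtm te n in
      let a := qpf le te he a in let b := qpf le te he b in constr:(PInd p a b n)
  | bool_ind ?p ?a ?b ?c =>
      let p := qtm te p in let c := qtm te c in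
      let a := qpf le te he a in let b := qpf le te he b in constr:(PCases p a b c)
  (* The calculus has no type variables, so a lemma applied to a type is looked up as a whole among
     the listed instances. *)
  | ?f ?a =>
      lazymatch type of a with
      | Set => qlem t le
      | Type => qlem t le
      | ?T =>
        match goal with
        | _ => let _ := lazymatch goal with _ => is_formula T end in let f := qpf le te he f in let a := qpf le te he a in constr:(PApp f a)
        | _ => let f := qpf le te he f in let a := qtm te a in constr:(PInst f a)
        end
      end
  | _ =>
      match goal with
      | _ => let _ := lazymatch goal with _ => is_var t end in let n := qvar t he in constr:(PHyp n)
      | _ => qlem t le
      end
  end.

Ltac qscript le k l :=
  lazymatch l with
  | (?t, ?l) =>
      let T := type of t in
      let T := eval cbv beta in T in
      let p := qtm tt T in
      let b := unfold_head t in
      let a := qpf le tt tt b in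
      let r := qscript constr:(((t, k), le)) constr:(S k) l in
      constr:((p, a) :: r)
  | tt => constr:(@nil (raw * pf))
  end.


Unset Implicit Arguments.

(* The lemmas below are quoted by [qpf]: they are transparent, use no axiom, recurse with [nat_rect]
   only, and eliminate with [elim], since [destruct] would leave [match] in the proof terms. *)

Lemma true_or_false (b : bool) : b = true \/ b = false.
Proof. elim b; [left|right]; reflexivity. Defined.

Ltac by_cases b E := elim (true_or_false b); intros E.

Lemma true_false (b : bool) : b = true -> b = false -> False.
Proof. intros E F. change (if false then True else False). rewrite <- F, E. exact I. Defined.

Lemma bool_ext (a b : bool) : (a = true -> b = true) -> (b = true -> a = true) -> a = b.
Proof.
  intros P Q. by_cases a A.
  - rewrite A. symmetry. apply P, A.
  - by_cases b C; [|rewrite A, C; reflexivity].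
    elim (true_false a); [apply Q, C|exact A].
Defined.

(** Equality of booleans is decidable. This is what later discharges the double negations in the
    Myhill property. *)
Lemma bool_stable (a b : bool) : ~ ~ a = b -> a = b.
Proof.
  intros N. by_cases a A; by_cases b C; try (rewrite A, C; reflexivity); elim N; intros E.
  - apply (true_false b); [rewrite <- E; exact A|exact C].
  - apply (true_false b); [exact C|rewrite <- E; exact A].
Defined.

Definition neg (a : bool) : bool := if a then false else true.
Definition conj2 (a b : bool) : bool := if a then b else false.
Definition disj2 (a b : bool) : bool := if a then true else b.
Definition xor (a b : bool) : bool := if a then neg b else b.

Lemma conj2_l (a b : bool) : conj2 a b = true -> a = true.
Proof. elim a; intros E; [reflexivity|exact E]. Defined.

Lemma conj2_r (a b : bool) : conj2 a b = true -> b = true.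
Proof. elim a; intros E; [exact E|]. elim (true_false false E); reflexivity. Defined.

Lemma conj2_intro (a b : bool) : a = true -> b = true -> conj2 a b = true.
Proof. intros E F. rewrite E. exact F. Defined.

Lemma disj2_false_l (a b : bool) : disj2 a b = false -> a = false.
Proof. elim a; intros E; [exact E|reflexivity]. Defined.

Lemma disj2_false_r (a b : bool) : disj2 a b = false -> b = false.
Proof. elim a; intros E; [elim (true_false true); [reflexivity|exact E]|exact E]. Defined.

Lemma disj2_false (a b : bool) : a = false -> b = false -> disj2 a b = false.
Proof. intros E F. rewrite E. exact F. Defined.

Lemma neg_true (a : bool) : neg a = true -> a = false.
Proof. elim a; intros E; [symmetry; exact E|reflexivity]. Defined.

Lemma neg_fix (a : bool) : a = neg a -> False.
Proof. elim a; intros E; [apply (true_false true); [reflexivity|exact E]|apply (true_false false); [exact E|reflexivity]]. Defined.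

Definition positive (n : nat) : bool := nat_rect (fun _ => bool) false (fun _ _ => true) n.

Definition lt (m n : nat) : bool :=
  nat_rect (fun _ => nat -> bool) (fun n => positive n)
    (fun _ r n => nat_rect (fun _ => bool) false (fun k _ => r k) n) m n.

Definition eqn (m n : nat) : bool :=
  nat_rect (fun _ => nat -> bool) (fun n => neg (positive n))
    (fun _ r n => nat_rect (fun _ => bool) false (fun k _ => r k) n) m n.

Definition plus (m n : nat) : nat := nat_rect (fun _ => nat) m (fun _ r => S r) n.

Definition odd (n : nat) : bool := nat_rect (fun _ => bool) false (fun _ r => neg r) n.

Lemma plus_0 (n : nat) : plus O n = n.
Proof. induction n as [|n IH]; [reflexivity|]. change (S (plus O n) = S n). rewrite IH. reflexivity. Defined.

Lemma plus_S (m n : nat) : plus (S m) n = S (plus m n).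
Proof.
  induction n as [|n IH]; [reflexivity|].
  change (S (plus (S m) n) = S (S (plus m n))). rewrite IH. reflexivity.
Defined.

Lemma xor_neg (a b : bool) : xor a (neg b) = neg (xor a b).
Proof. elim a; elim b; reflexivity. Defined.

Lemma odd_plus (m n : nat) : odd (plus m n) = xor (odd m) (odd n).
Proof.
  induction n as [|n IH].
  - change (odd m = xor (odd m) false). elim (odd m); reflexivity.
  - change (neg (odd (plus m n)) = xor (odd m) (neg (odd n))). rewrite IH, xor_neg. reflexivity.
Defined.

Lemma lt_0 (m : nat) : lt m O = false.
Proof. elim m; intros; reflexivity. Defined.

Lemma eqn_refl (n : nat) : eqn n n = true.
Proof. induction n as [|n IH]; [reflexivity|exact IH]. Defined.

Lemma eqn_eq (m : nat) : forall n, eqn m n = true -> m = n.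
Proof.
  induction m as [|m IH]; intros n; elim n.
  - intros E; reflexivity.
  - intros k _ E. elim (true_false false E); reflexivity.
  - intros E. elim (true_false false E); reflexivity.
  - intros k _ E. rewrite (IH k E). reflexivity.
Defined.

(** The two cases exclude each other, so the disjunction can be written with [xor], the form that
    sums modulo two require. *)
Lemma lt_succ (m : nat) : forall n, lt m (S n) = xor (lt m n) (eqn m n).
Proof.
  induction m as [|m IH]; intros n; elim n.
  - reflexivity.
  - intros k _. reflexivity.
  - change (lt m O = false). apply lt_0.
  - intros k _. exact (IH k).
Defined.

Lemma lt_irrefl (n : nat) : lt n n = false.
Proof. induction n as [|n IH]; [reflexivity|exact IH]. Defined.

Lemma lt_S (m : nat) : forall n, lt m n = true -> lt m (S n) = true.
Proof.
  induction m as [|m IH]; intros n; elim n.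
  - intros; reflexivity.
  - intros; reflexivity.
  - intros E. elim (true_false false E); reflexivity.
  - intros k _ E. exact (IH k E).
Defined.

Lemma lt_succ_cases (m n : nat) : lt m (S n) = true -> lt m n = true \/ m = n.
Proof.
  rewrite lt_succ. by_cases (lt m n) E; intros F; [left; exact E|right].
  rewrite E in F. apply eqn_eq. exact F.
Defined.

Lemma lt_diff (m : nat) : forall n, lt m n = true -> exists k, n = plus (S k) m.
Proof.
  induction m as [|m IH]; intros n; elim n.
  - intros E. elim (true_false false E); reflexivity.
  - intros k _ _. exists k. reflexivity.
  - intros E. elim (true_false false E); reflexivity.
  - intros k _ E. elim (IH k E). intros j J. exists j. rewrite J. reflexivity.
Defined.

Lemma nlt_diff (m : nat) : forall n, lt n m = false -> exists k, n = plus m k.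
Proof.
  induction m as [|m IH]; intros n; elim n.
  - intros _. exists O. reflexivity.
  - intros k _ _. exists (S k). rewrite plus_0. reflexivity.
  - intros E. elim (true_false true); [reflexivity|exact E].
  - intros k _ E. elim (IH k E). intros j J. exists j. rewrite J, plus_S. reflexivity.
Defined.

Lemma lt_plus_r (m n k : nat) : lt m n = true -> lt m (plus n k) = true.
Proof. intros E. induction k as [|k IH]; [exact E|]. exact (lt_S m (plus n k) IH). Defined.

Lemma lt_plus_l (m n k : nat) : lt (plus m n) (plus m k) = lt n k.
Proof.
  induction m as [|m IH]; [rewrite !plus_0; reflexivity|].
  rewrite !plus_S. exact IH.
Defined.

Lemma first_true (n : nat) : forall p : nat -> bool, p n = true ->
  exists c, p c = true /\ (forall k, lt k c = true -> p k = false).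
Proof.
  induction n as [|n IH]; intros p E.
  - exists O. split; [exact E|]. intros k. rewrite lt_0. intros F.
    elim (true_false false F); reflexivity.
  - by_cases (p O) Z.
    + exists O. split; [exact Z|]. intros k. rewrite lt_0. intros F.
      elim (true_false false F); reflexivity.
    + elim (IH (fun k => p (S k)) E). intros c C. exists (S c). split.
      * exact (proj1 C).
      * intros k. elim k; [intros _; exact Z|]. intros j _. apply (proj2 C).
Defined.

(** * Ishihara's tricks *)

Section Window.
(** [G] extends [F] to convergent sequences: a binary sequence [w] codes the place of a true entry,
    or infinity if there is none. [G_true] says that the value at infinity is false, in the positive
    form that Markov's principle provides. *)
Variable F : nat -> bool.
Variable G : (nat -> bool) -> bool.
Hypothesis G_true : forall w, G w = true -> exists n, w n = true.
Hypothesis G_first : forall w n, w n = true -> exists c, w c = true /\ G w = F c.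

(** On a decidable subset [w] of [F], a true entry would make [G w] a value of [F] inside that
    subset, hence true. Together with [G_true], [G] thus decides whether such a subset is inhabited;
    [some_from] applies this to the part of [F] from [m] on. *)
Lemma G_false (w : nat -> bool) :
  (forall n, w n = true -> F n = true) -> G w = false -> forall n, w n = false.
Proof.
  intros S E n. by_cases (w n) W; [|exact W].
  elim (G_first w n W). intros c C. elim (true_false (G w)); [|exact E].
  rewrite (proj2 C). apply S, (proj1 C).
Defined.

Definition some_from (m : nat) : bool := G (fun n => conj2 (neg (lt n m)) (F n)).

Lemma some_from_false (m : nat) :
  some_from m = false -> forall c, lt c m = false -> F c = false.
Proof.
  intros E c C.
  assert (Z : conj2 (neg (lt c m)) (F c) = false).
  { apply (G_false (fun n => conj2 (neg (lt n m)) (F n))); [|exact E].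
    intros n. exact (conj2_r (neg (lt n m)) (F n)). }
  rewrite C in Z. exact Z.
Defined.

Lemma some_from_true (m : nat) :
  some_from m = true -> exists c, lt c m = false /\ F c = true.
Proof.
  intros E. elim (G_true (fun n => conj2 (neg (lt n m)) (F n)) E). intros c C.
  exists c. split.
  - apply neg_true, (conj2_l (neg (lt c m)) (F c) C).
  - apply (conj2_r (neg (lt c m)) (F c) C).
Defined.

(** If [some_from] held at [m] but failed at [S m], its witness would be [m] itself, a last true
    value of [F]; the first premise excludes one. *)
Lemma all_some_from :
  G (fun n => conj2 (F n) (neg (some_from (S n)))) = false ->
  some_from O = true -> forall m, some_from m = true.
Proof.
  intros E Z m. induction m as [|m IH]; [exact Z|].
  by_cases (some_from (S m)) N; [exact N|].
  elim (some_from_true m IH). intros c C.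
  by_cases (lt c (S m)) L.
  - elim (lt_succ_cases c m L).
    + intros K. elim (true_false (lt c m) K). exact (proj1 C).
    + intros K. elim (true_false (conj2 (F c) (neg (some_from (S c))))).
      * apply conj2_intro; [exact (proj2 C)|]. rewrite K, N. reflexivity.
      * apply (G_false (fun n => conj2 (F n) (neg (some_from (S n))))); [|exact E].
        intros n. exact (conj2_l (F n) (neg (some_from (S n)))).
  - elim (true_false (F c)); [exact (proj2 C)|].
    exact (some_from_false (S m) N c L).
Defined.

Definition upto (p : nat -> bool) (n : nat) : bool :=
  nat_rect (fun _ => bool) (p O) (fun k r => disj2 r (p (S k))) n.

Lemma upto_true (p : nat -> bool) (n : nat) : upto p n = true -> exists k, p k = true.
Proof.
  induction n as [|n IH].
  - intros E. exists O. exact E.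
  - change (disj2 (upto p n) (p (S n)) = true -> exists k, p k = true).
    by_cases (upto p n) U; [intros _; exact (IH U)|].
    rewrite U. intros E. exists (S n). exact E.
Defined.

Lemma upto_plus (p : nat -> bool) (n k : nat) : p n = true -> upto p (plus n k) = true.
Proof.
  intros P. induction k as [|k IH].
  - change (upto p n = true). revert P. elim n; [intros P; exact P|].
    intros m _ P. change (disj2 (upto p m) (p (S m)) = true). rewrite P.
    elim (upto p m); reflexivity.
  - change (disj2 (upto p (plus n k)) (p (S (plus n k))) = true). rewrite IH. reflexivity.
Defined.

(** The true places of [F] by which [p] has already shown a true entry form a decidable subset of
    [F], so [G] decides whether there are any. As [F] is true arbitrarily late, every true entry of
    [p] is noticed at such a place. *)
Lemma lpo_of_all_some_from (p : nat -> bool) : (forall m, some_from m = true) ->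
  (forall n, p n = false) \/ (exists n, p n = true).
Proof.
  intros A. by_cases (G (fun n => conj2 (F n) (upto p n))) E.
  - right. elim (G_true (fun n => conj2 (F n) (upto p n)) E). intros n N.
    apply (upto_true p n). exact (conj2_r (F n) (upto p n) N).
  - left. intros n. by_cases (p n) P; [|exact P].
    elim (some_from_true n (A n)). intros c C.
    elim (nlt_diff n c (proj1 C)). intros k K.
    elim (true_false (conj2 (F c) (upto p c))).
    + apply conj2_intro; [exact (proj2 C)|]. rewrite K. exact (upto_plus p n k P).
    + apply (G_false (fun n => conj2 (F n) (upto p n))); [|exact E].
      intros m. exact (conj2_l (F m) (upto p m)).
Defined.

(* If some value of [F] is the last true one, [G] detects it; otherwise [F] is true infinitely often. *)
Lemma window_or_lpo (p : nat -> bool) :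
  (exists M, forall c, lt c M = false -> F c = false) \/
  ((forall n, p n = false) \/ (exists n, p n = true)).
Proof.
  by_cases (some_from O) Z.
  - by_cases (G (fun n => conj2 (F n) (neg (some_from (S n))))) E.
    + left. elim (G_true (fun n => conj2 (F n) (neg (some_from (S n)))) E). intros n N.
      exists (S n). apply some_from_false, neg_true.
      exact (conj2_r (F n) (neg (some_from (S n))) N).
    + right. exact (lpo_of_all_some_from p (all_some_from E Z)).
  - left. exists O. exact (some_from_false O Z).
Defined.
End Window.

(** * Counting modulo two *)

Definition xsum (f : nat -> bool) (n : nat) : bool :=
  nat_rect (fun _ => bool) false (fun k r => xor r (f k)) n.

Lemma xor_false_r (a : bool) : xor a false = a.
Proof. elim a; reflexivity. Defined.

Lemma xor_assoc (a b c : bool) : xor a (xor b c) = xor (xor a b) c.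
Proof. elim a; elim b; elim c; reflexivity. Defined.

Lemma xor_swap (a b c d : bool) : xor (xor a b) (xor c d) = xor (xor a c) (xor b d).
Proof. elim a; elim b; elim c; elim d; reflexivity. Defined.

Lemma xor_cancel (a : bool) : xor a a = false.
Proof. elim a; reflexivity. Defined.

Lemma xsum_ext (f g : nat -> bool) (n : nat) :
  (forall k, lt k n = true -> f k = g k) -> xsum f n = xsum g n.
Proof.
  induction n as [|n IH]; [reflexivity|]. intros E.
  change (xor (xsum f n) (f n) = xor (xsum g n) (g n)).
  rewrite (E n).
  - rewrite IH; [reflexivity|]. intros k K. apply E, lt_S, K.
  - rewrite lt_succ, lt_irrefl, eqn_refl. reflexivity.
Defined.

Lemma xsum_xor (f g : nat -> bool) (n : nat) :
  xsum (fun k => xor (f k) (g k)) n = xor (xsum f n) (xsum g n).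
Proof.
  induction n as [|n IH]; [reflexivity|].
  change (xor (xsum (fun k => xor (f k) (g k)) n) (xor (f n) (g n)) =
    xor (xor (xsum f n) (f n)) (xor (xsum g n) (g n))).
  rewrite IH. apply xor_swap.
Defined.

Lemma xsum_plus (f : nat -> bool) (m n : nat) :
  xsum f (plus m n) = xor (xsum f m) (xsum (fun c => f (plus m c)) n).
Proof.
  induction n as [|n IH].
  - change (xsum f m = xor (xsum f m) false). rewrite xor_false_r. reflexivity.
  - change (xor (xsum f (plus m n)) (f (plus m n)) =
      xor (xsum f m) (xor (xsum (fun c => f (plus m c)) n) (f (plus m n)))).
    rewrite IH, xor_assoc. reflexivity.
Defined.

Lemma xsum_false (n : nat) : xsum (fun _ => false) n = false.
Proof.
  induction n as [|n IH]; [reflexivity|].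
  change (xor (xsum (fun _ => false) n) false = false). rewrite IH. reflexivity.
Defined.

Lemma eqn_sym (m : nat) : forall n, eqn m n = eqn n m.
Proof.
  induction m as [|m IH]; intros n; elim n.
  - reflexivity.
  - intros k _. reflexivity.
  - reflexivity.
  - intros k _. exact (IH k).
Defined.

Lemma xsum_eqn (a n : nat) : xsum (fun k => eqn k a) n = lt a n.
Proof.
  induction n as [|n IH]; [rewrite lt_0; reflexivity|].
  change (xor (xsum (fun k => eqn k a) n) (eqn n a) = lt a (S n)).
  rewrite IH, lt_succ, (eqn_sym n a). reflexivity.
Defined.

Section Involution.
Variable iota : nat -> nat.
Variables n d : nat.
Hypothesis iota_iota : forall k, lt k (plus n d) = true -> lt (iota k) (plus n d) = true ->
  iota (iota k) = k.
Hypothesis iota_fix : forall k, lt k (plus n d) = true -> iota k = k -> False.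
Hypothesis iota_lt : forall k, lt k n = true -> lt (iota k) (plus n d) = true.

(** Since [iota] is an involution, [iota k = m] only for [k = iota m]: the sum has at most one
    nonzero term. The second premise expresses that [N] is at most [n + d]. *)
Lemma xsum_eqn_iota (m N : nat) : lt m (plus n d) = true ->
  (forall k, lt k N = true -> lt k (plus n d) = true) ->
  xsum (fun k => eqn (iota k) m) N = lt (iota m) N.
Proof.
  intros M S. rewrite <- xsum_eqn. apply xsum_ext. intros k K.
  apply bool_ext; intros E; apply eqn_eq in E.
  - rewrite <- E, iota_iota; [apply eqn_refl|apply S, K|rewrite E; exact M].
  - rewrite E, iota_iota; [apply eqn_refl|exact M|rewrite <- E; apply S, K].
Defined.

(** The indices below [m] whose partner is also below [m] come in pairs. *)
Lemma xsum_below (m : nat) : (forall k, lt k m = true -> lt k (plus n d) = true) ->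
  xsum (fun k => lt (iota k) m) m = false.
Proof.
  induction m as [|m IH]; [reflexivity|]. intros S.
  assert (S' : forall k, lt k m = true -> lt k (plus n d) = true).
  { intros k K. apply S, lt_S, K. }
  assert (M : lt m (plus n d) = true).
  { apply S. rewrite lt_succ, lt_irrefl, eqn_refl. reflexivity. }
  change (xor (xsum (fun k => lt (iota k) (Datatypes.S m)) m) (lt (iota m) (Datatypes.S m)) = false).
  rewrite (xsum_ext (fun k => lt (iota k) (Datatypes.S m))
    (fun k => xor (lt (iota k) m) (eqn (iota k) m)) m).
  (* The new index [m] counts once for itself and once for its partner, both exactly when [iota m]
     is below [m]; these contributions cancel. *)
  - rewrite xsum_xor, (IH S'), (xsum_eqn_iota m m M S'), lt_succ.
    by_cases (eqn (iota m) m) E.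
    + elim (iota_fix m M). apply eqn_eq. exact E.
    + rewrite E, xor_false_r. apply xor_cancel.
  - intros k _. apply lt_succ.
Defined.

(** Every value below [m] is taken exactly once on the indices below [n + d], namely at its partner,
    which [iota_lt] keeps in range. *)
Lemma xsum_all (m : nat) : (forall k, lt k m = true -> lt k n = true) ->
  xsum (fun k => lt (iota k) m) (plus n d) = odd m.
Proof.
  induction m as [|m IH]; intros L.
  - rewrite (xsum_ext (fun k => lt (iota k) O) (fun _ => false)).
    + apply xsum_false.
    + intros k _. apply lt_0.
  - assert (M : lt m n = true).
    { apply L. rewrite lt_succ, lt_irrefl, eqn_refl. reflexivity. }
    rewrite (xsum_ext (fun k => lt (iota k) (S m))
      (fun k => xor (lt (iota k) m) (eqn (iota k) m)) (plus n d)).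
    + rewrite xsum_xor, IH, (xsum_eqn_iota m (plus n d)).
      * rewrite (iota_lt m M). change (xor (odd m) true = neg (odd m)). elim (odd m); reflexivity.
      * apply lt_plus_r. exact M.
      * intros k K. exact K.
      * intros k K. apply L, lt_S, K.
    + intros k _. apply lt_succ.
Defined.

(** Exactly [n] indices below [n + d] have their partner below [n]; those that are themselves below
    [n] are even in number, so the rest have the parity of [n]. *)
Lemma xsum_crossing : xsum (fun c => lt (iota (plus n c)) n) d = odd n.
Proof.
  rewrite <- (xsum_all n).
  - rewrite xsum_plus, xsum_below; [reflexivity|].
    intros k K. apply lt_plus_r. exact K.
  - intros k K. exact K.
Defined.
End Involution.

(** Double negation commutes with finite conjunctions, so finitely many values can be chosen under a
    single double negation. *)
Lemma finite_choice (R : nat -> nat -> Prop) : (forall k, ~ ~ exists j, R k j) ->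
  forall n, ~ ~ exists f : nat -> nat, forall k, lt k n = true -> R k (f k).
Proof.
  intros C n. induction n as [|n IH].
  - intros N. apply N. exists (fun k => k). intros k. rewrite lt_0. intros E.
    elim (true_false false E); reflexivity.
  - intros N. apply IH. intros K. elim K. intros f F.
    apply (C n). intros J. elim J. intros j Rj. apply N.
    exists (fun k => if eqn k n then j else f k). intros k L.
    by_cases (eqn k n) E; rewrite E.
    + rewrite (eqn_eq k n E). exact Rj.
    + apply F. rewrite lt_succ, E, xor_false_r in L. exact L.
Defined.

(** * Injections of the form f = g = T *)

Definition it (X : Type) (T : X -> X) (n : nat) (x : X) : X :=
  nat_rect (fun _ => X) x (fun _ y => T y) n.

Lemma it_plus (X : Type) (T : X -> X) (m n : nat) (x : X) :
  it X T n (it X T m x) = it X T (plus m n) x.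
Proof.
  induction n as [|n IH]; [reflexivity|].
  change (T (it X T n (it X T m x)) = T (it X T (plus m n) x)). rewrite IH. reflexivity.
Defined.

Lemma it_inj (X : Type) (T : X -> X) (n : nat) : (forall x y, T x = T y -> x = y) ->
  forall x y, it X T n x = it X T n y -> x = y.
Proof.
  intros inj. induction n as [|n IH]; intros x y E; [exact E|].
  apply IH, inj. exact E.
Defined.

Lemma it_fix (X : Type) (T : X -> X) (n : nat) (x : X) : T x = x -> it X T n x = x.
Proof.
  intros E. induction n as [|n IH]; [reflexivity|].
  change (T (it X T n x) = x). rewrite IH. exact E.
Defined.

(** For [f = g = T] the relation indexed by an integer m is [T] to the power 2m + 1, so exactly the
    odd powers and their inverses occur. *)
Definition oddly_linked (X : Type) (T h : X -> X) : Prop :=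
  forall x, ~ ~ exists m, odd m = true /\ (h x = it X T m x \/ x = it X T m (h x)).

Lemma oddly_linked_inverse (X : Type) (T h k : X -> X) :
  (forall x, h (k x) = x) -> oddly_linked X T h -> oddly_linked X T k.
Proof.
  intros hk L x N. apply (L (k x)). intros E. elim E. intros m M. apply N. exists m.
  split; [exact (proj1 M)|]. rewrite hk in M. elim (proj2 M).
  - intros F. right. exact F.
  - intros F. left. exact F.
Defined.

(** Every iterate of [T] fixes [x]; in the backward case the iterate is cancelled by injectivity. *)
Lemma linked_fix (X : Type) (T h : X -> X) (x : X) : (forall x y, T x = T y -> x = y) ->
  oddly_linked X T h -> T x = x -> ~ ~ h x = x.
Proof.
  intros inj L E N. apply (L x). intros K. elim K. intros m M. apply N. elim (proj2 M).
  - rewrite (it_fix X T m x E). intros F. exact F.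
  - intros F. apply (it_inj X T m inj). rewrite <- F, (it_fix X T m x E). reflexivity.
Defined.

Section Chain.
Variable X : Type.
Variables T h k : X -> X.
Hypothesis T_inj : forall x y, T x = T y -> x = y.
Hypothesis hk : forall x, h (k x) = x.
Hypothesis kh : forall x, k (h x) = x.
Hypothesis h_linked : oddly_linked X T h.
Hypothesis k_linked : oddly_linked X T k.
Variable s : X.
Hypothesis s_initial : forall x, T x = s -> False.

Lemma chain_inj (a : nat) : forall b, it X T a s = it X T b s -> a = b.
Proof.
  induction a as [|a IH]; intros b; elim b.
  - intros _. reflexivity.
  - intros c _ E. elim (s_initial (it X T c s)). symmetry. exact E.
  - intros E. elim (s_initial (it X T a s)). exact E.
  - intros c _ E. rewrite (IH c); [reflexivity|]. apply T_inj. exact E.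
Defined.

(** Going back along [T] from a point of the chain cannot pass [s], which has no preimage; so the
    predecessors stay in the chain. *)
Lemma chain_pred (m : nat) : forall a w, it X T m w = it X T a s ->
  exists j, w = it X T j s /\ plus j m = a.
Proof.
  induction m as [|m IH]; intros a w.
  - intros E. exists a. split; [exact E|reflexivity].
  - elim a.
    + intros E. elim (s_initial (it X T m w)). exact E.
    + intros b _ E. elim (IH b w).
      * intros j J. exists j. split; [exact (proj1 J)|]. rewrite <- (proj2 J). reflexivity.
      * apply T_inj. exact E.
Defined.

Lemma chain_step (f : X -> X) (a : nat) : oddly_linked X T f ->
  ~ ~ exists j, f (it X T a s) = it X T j s /\ odd j = neg (odd a).
Proof.
  intros L N. apply (L (it X T a s)). intros K. elim K. intros m M. apply N. elim (proj2 M).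
  - intros E. exists (plus a m). split.
    + rewrite E. apply it_plus.
    + rewrite odd_plus, (proj1 M). elim (odd a); reflexivity.
  - intros E. elim (chain_pred m a (f (it X T a s))).
    + intros j J. exists j. split; [exact (proj1 J)|].
      rewrite <- (proj2 J), odd_plus, (proj1 M). elim (odd j); reflexivity.
    + symmetry. exact E.
Defined.

Variable nu : X -> bool.
Variables n d : nat.
Hypothesis nu_chain : forall a, nu (it X T a s) = lt a n.
Hypothesis nu_window : forall a, lt a (plus n d) = false ->
  nu (h (it X T a s)) = false /\ nu (k (it X T a s)) = false.

(* Taking [h] and its inverse alternately makes the correspondence of indices an involution. *)
Definition alt (a : nat) (x : X) : X := if xor (odd n) (odd a) then k x else h x.

(** Partners have opposite parity, so [alt] uses [h] at one and its inverse at the other. *)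
Lemma alt_flip (a b : nat) :
  alt a (it X T a s) = it X T b s /\ odd b = neg (odd a) ->
  alt b (it X T b s) = it X T a s /\ odd a = neg (odd b).
Proof.
  intros E. split.
  - rewrite <- (proj1 E). unfold alt. rewrite (proj2 E), xor_neg.
    elim (xor (odd n) (odd a)); [apply hk|apply kh].
  - rewrite (proj2 E). elim (odd a); reflexivity.
Defined.

Lemma alt_window (a : nat) : lt a (plus n d) = false -> nu (alt a (it X T a s)) = false.
Proof.
  intros E. unfold alt. elim (xor (odd n) (odd a)).
  - exact (proj2 (nu_window a E)).
  - exact (proj1 (nu_window a E)).
Defined.

Lemma alt_linked (a : nat) : ~ ~ exists b, alt a (it X T a s) = it X T b s /\ odd b = neg (odd a).
Proof.
  unfold alt. elim (xor (odd n) (odd a)); apply chain_step; [exact k_linked|exact h_linked].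
Defined.

(** An equation between booleans is stable, so the partners of the indices below [n + d] may be
    chosen under a double negation; they form an involution without fixed points, and the crossings
    are counted by [xsum_crossing]. *)
Lemma parity_of_chain : xsum (fun c => nu (alt (plus n c) (it X T (plus n c) s))) d = odd n.
Proof.
  apply bool_stable. intros N.
  apply (finite_choice (fun a b => alt a (it X T a s) = it X T b s /\ odd b = neg (odd a))
    alt_linked (plus n d)).
  intros K. elim K. intros iota I. apply N.
  rewrite (xsum_ext (fun c => nu (alt (plus n c) (it X T (plus n c) s)))
    (fun c => lt (iota (plus n c)) n)).
  - apply xsum_crossing.
    + intros a A B. apply chain_inj. rewrite <- (proj1 (I (iota a) B)).
      exact (proj1 (alt_flip a (iota a) (I a A))).
    + intros a A E. apply (neg_fix (odd a)). rewrite <- (proj2 (I a A)), E. reflexivity.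
    (* If the partner of an index below [n] lay outside the window, [alt] would carry it back below
       [n], against [alt_window]. *)
    + intros a A. by_cases (lt (iota a) (plus n d)) B; [exact B|].
      elim (true_false (nu (alt (iota a) (it X T (iota a) s)))).
      * rewrite (proj1 (alt_flip a (iota a) (I a (lt_plus_r a n d A)))), nu_chain. exact A.
      * apply alt_window. exact B.
  - intros c C. rewrite (proj1 (I (plus n c) (eq_trans (lt_plus_l n c d) C))). apply nu_chain.
Defined.
End Chain.

(** * The counterexample *)

Section Sequences.
Variable B : Type.
Hypothesis funext : forall f g : nat -> B, (forall n, f n = g n) -> f = g.

Definition cons (b : B) (u : nat -> B) : nat -> B :=
  fun n => nat_rect (fun _ => B) b (fun k _ => u k) n.
Definition tl (u : nat -> B) : nat -> B := fun n => u (S n).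

Lemma tl_cons (b : B) (u : nat -> B) : tl (cons b u) = u.
Proof. apply funext. intros n. reflexivity. Defined.

Lemma cons_ext (u v : nat -> B) : u O = v O -> tl u = tl v -> u = v.
Proof.
  intros E F. apply funext. intros n. elim n; [exact E|]. intros k _.
  change (tl u k = tl v k). rewrite F. reflexivity.
Defined.

Definition double (n : nat) : nat := nat_rect (fun _ => nat) O (fun _ r => S (S r)) n.
Definition evens (x : nat -> B) : nat -> B := fun n => x (double n).
Definition odds (x : nat -> B) : nat -> B := fun n => x (S (double n)).
(** The inverse of the pairing by even and odd places; the recursion exchanges the two sequences at
    each step. *)
Definition merge (u v : nat -> B) : nat -> B := fun n =>
  nat_rect (fun _ => (nat -> B) -> (nat -> B) -> B) (fun u _ => u O)
    (fun _ r u v => r v (tl u)) n u v.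

Lemma evens_merge (u v : nat -> B) : evens (merge u v) = u.
Proof.
  apply funext. intros n. revert u v. induction n as [|n IH]; intros u v; [reflexivity|].
  exact (IH (tl u) (tl v)).
Defined.

Lemma odds_merge (u v : nat -> B) : odds (merge u v) = v.
Proof.
  apply funext. intros n. revert u v. induction n as [|n IH]; intros u v; [reflexivity|].
  exact (IH (tl u) (tl v)).
Defined.

Lemma merge_evens_odds (x : nat -> B) : merge (evens x) (odds x) = x.
Proof.
  apply funext. intros n. revert x. induction n as [|n IH]; intros x; [reflexivity|].
  exact (IH (tl x)).
Defined.

Variables o i : B.
Variable is_o : B -> bool.
Hypothesis is_o_o : is_o o = true.
Hypothesis is_o_i : is_o i = false.

(* With x = (u, v) read as the two-sided sequence ... v1 v0 | u0 u1 ..., T moves u0 to v while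
   u0 = o, and otherwise it copies u0 to v.  If q is o^n i ... with n > 0, the point (i^w, q) is
   T^n s with s = (o^n i^w, i ...) outside the image of T. *)
Definition T (x : nat -> B) : nat -> B :=
  merge (if is_o (evens x O) then tl (evens x) else evens x) (cons (evens x O) (odds x)).

Definition neg_side (x : nat -> B) : bool := is_o (evens x O).

Lemma evens_T (x : nat -> B) :
  evens (T x) = (if is_o (evens x O) then tl (evens x) else evens x).
Proof. apply evens_merge. Defined.

Lemma odds_T (x : nat -> B) : odds (T x) = cons (evens x O) (odds x).
Proof. apply odds_merge. Defined.

(** The head of the odd part of [T x] is the symbol that was moved or copied, and so reveals which
    branch was taken. *)
Lemma T_inj (x y : nat -> B) : T x = T y -> x = y.
Proof.
  intros E.
  assert (C : cons (evens x O) (odds x) = cons (evens y O) (odds y)).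
  { rewrite <- !odds_T, E. reflexivity. }
  assert (H : evens x O = evens y O).
  { change (cons (evens x O) (odds x) O = cons (evens y O) (odds y) O). rewrite C. reflexivity. }
  assert (O : odds x = odds y).
  { rewrite <- (tl_cons (evens x O) (odds x)), C. apply tl_cons. }
  assert (K : (if is_o (evens x Datatypes.O) then tl (evens x) else evens x) =
              (if is_o (evens y Datatypes.O) then tl (evens y) else evens y)).
  { rewrite <- !evens_T, E. reflexivity. }
  assert (D : evens x = evens y).
  { by_cases (is_o (evens y Datatypes.O)) Z; rewrite H, Z in K.
    - apply cons_ext; [exact H|exact K].
    - exact K. }
  rewrite <- (merge_evens_odds x), D, O. apply merge_evens_odds.
Defined.

Definition ones : nat -> B := fun _ => i.
Definition start (q : nat -> B) : nat -> B := merge ones q.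

Lemma T_ones (v : nat -> B) : T (merge ones v) = merge ones (cons i v).
Proof.
  unfold T. rewrite evens_merge, odds_merge.
  change (merge (if is_o i then tl ones else ones) (cons i v) = merge ones (cons i v)).
  rewrite is_o_i. reflexivity.
Defined.

Lemma neg_side_start (q : nat -> B) (c : nat) :
  neg_side (it (nat -> B) T c (start q)) = false.
Proof.
  assert (E : exists v, it (nat -> B) T c (start q) = merge ones v).
  { induction c as [|c IH].
    - exists q. reflexivity.
    - elim IH. intros v V. exists (cons i v).
      change (T (it (nat -> B) T c (start q)) = merge ones (cons i v)).
      rewrite V. apply T_ones. }
  elim E. intros v V. rewrite V. unfold neg_side. rewrite evens_merge. exact is_o_i.
Defined.

Definition pad (n : nat) : nat -> B := nat_rect (fun _ => nat -> B) ones (fun _ r => cons o r) n.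
Definition drop (n : nat) (q : nat -> B) : nat -> B := fun k => q (plus n k).
(** The point [n] steps before [start q], provided that the first [n] entries of [q] are [o]. *)
Definition back (q : nat -> B) (n : nat) : nat -> B := merge (pad n) (drop n q).

Lemma back_0 (q : nat -> B) : back q O = start q.
Proof.
  assert (E : drop O q = q).
  { apply funext. intros n. unfold drop. rewrite plus_0. reflexivity. }
  unfold back. rewrite E. reflexivity.
Defined.

Lemma T_back (q : nat -> B) (n : nat) : q n = o -> T (back q (S n)) = back q n.
Proof.
  intros E. unfold T, back. rewrite evens_merge, odds_merge.
  change (merge (if is_o o then tl (cons o (pad n)) else cons o (pad n)) (cons o (drop (S n) q)) =
    merge (pad n) (drop n q)).
  rewrite is_o_o, tl_cons.
  assert (D : cons o (drop (S n) q) = drop n q).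
  { apply cons_ext; [symmetry; exact E|]. rewrite tl_cons. apply funext. intros k.
    change (q (plus (S n) k) = q (S (plus n k))). rewrite plus_S. reflexivity. }
  rewrite D. reflexivity.
Defined.

Lemma it_back (q : nat -> B) (m : nat) : forall k,
  (forall j, lt j (plus m k) = true -> q j = o) ->
  it (nat -> B) T k (back q (plus m k)) = back q m.
Proof.
  intros k. revert m. induction k as [|k IH]; intros m Z; [reflexivity|].
  change (T (it (nat -> B) T k (back q (S (plus m k)))) = back q m).
  rewrite <- plus_S, IH.
  - apply T_back. apply Z. change (lt (plus m O) (plus m (S k)) = true).
    rewrite lt_plus_l. reflexivity.
  - intros j. rewrite plus_S. exact (Z j).
Defined.

Lemma neg_side_back (q : nat -> B) (n : nat) : neg_side (back q (S n)) = true.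
Proof. unfold neg_side, back. rewrite evens_merge. exact is_o_o. Defined.

(** A preimage would have put [i] at the head of the odd part, hence by the copying branch, which
    leaves [i] at the head of the even part; but that head is [o]. The index is a successor so that
    this [o] exists. *)
Lemma back_initial (q : nat -> B) (n : nat) (x : nat -> B) :
  q (S n) = i -> T x = back q (S n) -> False.
Proof.
  intros Q E.
  assert (H : evens x O = i).
  { change (cons (evens x O) (odds x) O = i). rewrite <- odds_T, E.
    unfold back. rewrite odds_merge. exact Q. }
  apply (true_false (is_o (evens (T x) O))).
  - rewrite E. exact (neg_side_back q n).
  - rewrite evens_T, H, is_o_i, H. exact is_o_i.
Defined.

Lemma neg_side_chain (q : nat -> B) (n : nat) : (forall j, lt j n = true -> q j = o) ->
  forall a, neg_side (it (nat -> B) T a (back q n)) = lt a n.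
Proof.
  intros Z a. by_cases (lt a n) L.
  - elim (lt_diff a n L). intros k K. rewrite K in Z |- *. rewrite (it_back q (S k) a Z).
    rewrite neg_side_back, <- K. symmetry. exact L.
  - elim (nlt_diff n a L). intros k K. rewrite L, K, <- it_plus.
    assert (E : it (nat -> B) T n (back q n) = start q).
    { rewrite <- (plus_0 n) in Z |- *. rewrite <- (back_0 q).
      rewrite <- (it_back q O n Z), !plus_0. reflexivity. }
    rewrite E. apply neg_side_start.
Defined.

Variables h k : (nat -> B) -> nat -> B.
Hypothesis hk : forall x, h (k x) = x.
Hypothesis kh : forall x, k (h x) = x.
Hypothesis h_linked : oddly_linked (nat -> B) T h.
Hypothesis k_linked : oddly_linked (nat -> B) T k.

Definition crosses (x : nat -> B) : bool := disj2 (neg_side (h x)) (neg_side (k x)).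

(** The choice between [h] and its inverse depends on the offset [c] from [start q] only, so the sum
    is computed without knowing where the first [i] of [q] is. *)
Definition parity (q : nat -> B) (d : nat) : bool :=
  xsum (fun c => neg_side
    (if odd c then k (it (nat -> B) T c (start q)) else h (it (nat -> B) T c (start q)))) d.

(** The chain begins at [back q (S n)], and its point of index [S n + c] is the [c]-th iterate at
    [start q]. *)
Lemma parity_first (q : nat -> B) (n d : nat) :
  (forall j, lt j (S n) = true -> q j = o) -> q (S n) = i ->
  (forall c, lt c d = false -> crosses (it (nat -> B) T c (start q)) = false) ->
  parity q d = odd (S n).
Proof.
  intros Z Q W.
  assert (E : forall c, it (nat -> B) T (plus (S n) c) (back q (S n)) = it (nat -> B) T c (start q)).
  { intros c. rewrite <- it_plus, <- (back_0 q).
    rewrite <- (it_back q O (S n)); rewrite plus_0; [reflexivity|exact Z]. }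
  rewrite <- (parity_of_chain (nat -> B) T h k T_inj hk kh h_linked k_linked (back q (S n))
    (fun x => back_initial q n x Q) neg_side (S n) d).
  (* The term [odd n] in [alt] cancels the parity of the shift by [S n], leaving the parity of
     [c]. *)
  - apply xsum_ext. intros c _. rewrite (E c). unfold alt. rewrite odd_plus.
    elim (odd (S n)); elim (odd c); reflexivity.
  - apply neg_side_chain. exact Z.
  - intros a A. elim (nlt_diff (plus (S n) d) a A). intros c C.
    assert (P : exists b, a = plus (S n) b /\ lt b d = false).
    { by_cases (lt a (S n)) L.
      - elim (true_false (lt a (plus (S n) d))); [|exact A]. apply lt_plus_r. exact L.
      - elim (nlt_diff (S n) a L). intros b F. exists b. split; [exact F|].
        rewrite F, lt_plus_l in A. exact A. }
    elim P. intros b F. rewrite (proj1 F), (E b). split.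
    + apply (disj2_false_l _ _ (W b (proj2 F))).
    + apply (disj2_false_r _ _ (W b (proj2 F))).
Defined.

(* [z w q] is [T^c (start q)] when the first [true] of [w] is at [c], and it is fixed by [T] when
   there is none: this makes the forward orbit of [start q] converge, in the sense that
   Ishihara's tricks need. *)
Definition z (w : nat -> bool) (q : nat -> B) : nat -> B :=
  merge ones (fun n =>
    nat_rect (fun _ => (nat -> bool) -> B) (fun w => if w O then q O else i)
      (fun n r w => if w O then q (S n) else r (fun j => w (S j))) n w).

Lemma z_true (w : nat -> bool) (q : nat -> B) : w O = true -> z w q = start q.
Proof.
  intros E. unfold z, start. apply (f_equal (merge ones)). apply funext. intros n.
  elim n.
  - change ((if w O then q O else i) = q O). rewrite E. reflexivity.
  - intros m _.
    change ((if w O then q (S m) else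
      nat_rect (fun _ => (nat -> bool) -> B) (fun w => if w O then q O else i)
      (fun n r w => if w O then q (S n) else r (fun j => w (S j))) m (fun j => w (S j))) = q (S m)).
    rewrite E. reflexivity.
Defined.

Lemma z_false (w : nat -> bool) (q : nat -> B) :
  w O = false -> z w q = T (z (fun j => w (S j)) q).
Proof.
  intros E. unfold z at 2. rewrite T_ones. unfold z. apply (f_equal (merge ones)).
  apply funext. intros n. elim n.
  - change ((if w O then q O else i) = i). rewrite E. reflexivity.
  - intros m _.
    change ((if w O then q (S m) else
      nat_rect (fun _ => (nat -> bool) -> B) (fun w => if w O then q O else i)
      (fun n r w => if w O then q (S n) else r (fun j => w (S j))) m (fun j => w (S j))) =
      nat_rect (fun _ => (nat -> bool) -> B) (fun w => if w O then q O else i)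
      (fun n r w => if w O then q (S n) else r (fun j => w (S j))) m (fun j => w (S j))).
    rewrite E. reflexivity.
Defined.

Lemma z_first (n : nat) : forall w, w n = true ->
  exists c, w c = true /\ forall q, z w q = it (nat -> B) T c (start q).
Proof.
  induction n as [|n IH]; intros w W.
  - exists O. split; [exact W|]. intros q. apply z_true. exact W.
  - by_cases (w O) E.
    + exists O. split; [exact E|]. intros q. apply z_true. exact E.
    + elim (IH (fun j => w (S j)) W). intros c C. exists (S c). split; [exact (proj1 C)|].
      intros q. rewrite (z_false w q E), (proj2 C). reflexivity.
Defined.

(** Here [z] is the pair of two constant sequences [i], a fixed point of [T]. Both bijections fix it
    up to double negation, which suffices for a boolean value. *)
Lemma crosses_fixed (q : nat -> B) : crosses (z (fun _ => false) q) = false.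
Proof.
  assert (F : T (z (fun _ => false) q) = z (fun _ => false) q).
  { symmetry. exact (z_false (fun _ => false) q eq_refl). }
  assert (N : neg_side (z (fun _ => false) q) = false).
  { unfold neg_side, z. rewrite evens_merge. exact is_o_i. }
  apply disj2_false; apply bool_stable; intros C.
  - apply (linked_fix (nat -> B) T h (z (fun _ => false) q) T_inj h_linked F).
    intros E. apply C. rewrite E. exact N.
  - apply (linked_fix (nat -> B) T k (z (fun _ => false) q) T_inj k_linked F).
    intros E. apply C. rewrite E. exact N.
Defined.

(** The leading [o] puts the first [i] at a positive index, as [back_initial] requires. One more [o]
    in front shifts that index by one. *)
Definition code (p : nat -> bool) : nat -> B := cons o (fun n => if p n then i else o).

Lemma code_first (p : nat -> bool) (c : nat) :
  p c = true -> (forall j, lt j c = true -> p j = false) ->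
  code p (S c) = i /\ forall j, lt j (S c) = true -> code p j = o.
Proof.
  intros P Z. split.
  - change ((if p c then i else o) = i). rewrite P. reflexivity.
  - intros j. elim j; [reflexivity|]. intros m _ L.
    change ((if p m then i else o) = o). rewrite (Z m L). reflexivity.
Defined.

Lemma parity_code (p : nat -> bool) (n d : nat) : p n = true ->
  (forall c, lt c d = false -> crosses (it (nat -> B) T c (start (code p))) = false) ->
  (forall c, lt c d = false -> crosses (it (nat -> B) T c (start (cons o (code p)))) = false) ->
  parity (cons o (code p)) d = neg (parity (code p) d).
Proof.
  intros P W V. elim (first_true n p P). intros c C.
  assert (K : code p (S c) = i /\ forall j, lt j (S c) = true -> code p j = o).
  { apply code_first; [exact (proj1 C)|exact (proj2 C)]. }
  rewrite (parity_first (code p) c d (proj2 K) (proj1 K) W).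
  rewrite (parity_first (cons o (code p)) (S c) d); [reflexivity| |exact (proj1 K)|exact V].
  intros j. elim j; [reflexivity|]. intros m _ L. exact (proj2 K m L).
Defined.

Hypothesis funext2 : forall f g : nat -> bool, (forall n, f n = g n) -> f = g.
Hypothesis markov : forall p : nat -> bool, ~ p = (fun _ => false) -> exists n, p n = true.

Lemma parity_code_false (p : nat -> bool) (d : nat) : (forall n, p n = false) ->
  parity (cons o (code p)) d = parity (code p) d.
Proof.
  intros Z.
  assert (E : cons o (code p) = code p).
  { apply funext. intros n. elim n; [reflexivity|]. intros m _.
    change (code p m = (if p m then i else o)). rewrite (Z m). elim m; [reflexivity|].
    intros j _. change ((if p j then i else o) = o). rewrite (Z j). reflexivity. }
  rewrite E. reflexivity.
Defined.

(** Different parities refute that [p] is constantly false, and Markov's principle finds a true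
    entry; equal parities exclude every true entry. *)
Lemma lpo_of_window (p : nat -> bool) (d : nat) :
  (forall c, lt c d = false -> crosses (it (nat -> B) T c (start (code p))) = false) ->
  (forall c, lt c d = false -> crosses (it (nat -> B) T c (start (cons o (code p)))) = false) ->
  p = (fun _ => false) \/ (exists n, p n = true).
Proof.
  intros W V. by_cases (xor (parity (cons o (code p)) d) (parity (code p) d)) E.
  - right. apply markov. intros Z. apply (true_false (xor (parity (cons o (code p)) d) (parity (code p) d)) E).
    rewrite (parity_code_false p d); [apply xor_cancel|]. intros n. rewrite Z. reflexivity.
  - left. apply funext2. intros n. by_cases (p n) P; [|exact P].
    elim (true_false (xor (parity (cons o (code p)) d) (parity (code p) d))); [|exact E].
    rewrite (parity_code p n d P W V). elim (parity (code p) d); reflexivity.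
Defined.

Lemma lpo_of_linked (p : nat -> bool) : p = (fun _ => false) \/ (exists n, p n = true).
Proof.
  (* Crossings for both codes are combined in one sequence, so that a single bound serves both. *)
  elim (window_or_lpo
    (fun c => disj2 (crosses (it (nat -> B) T c (start (code p))))
                    (crosses (it (nat -> B) T c (start (cons o (code p))))))
    (fun w => disj2 (crosses (z w (code p))) (crosses (z w (cons o (code p)))))) with (p := p).
  - intros E. elim E. intros d D. apply (lpo_of_window p d).
    + intros c C. apply (disj2_false_l _ _ (D c C)).
    + intros c C. apply (disj2_false_r _ _ (D c C)).
  - intros E. elim E.
    + intros Z. left. apply funext2. exact Z.
    + intros P. right. exact P.
  (* Were [w] constantly false, [z w] would be the fixed point, where nothing crosses. *)
  - intros w E. apply markov. intros Z. rewrite Z in E.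
    apply (true_false (disj2 (crosses (z (fun _ => false) (code p)))
      (crosses (z (fun _ => false) (cons o (code p)))))); [exact E|].
    apply disj2_false; apply crosses_fixed.
  - intros w n W. elim (z_first n w W). intros c C. exists c. split; [exact (proj1 C)|].
    rewrite !(proj2 C). reflexivity.
Defined.
End Sequences.

(** * From the Myhill property to omniscience *)

Definition myhill (X : Type) : Prop := forall f g : X -> X,
  (forall x y, f x = f y -> x = y) /\ (forall x y, g x = g y -> x = y) ->
  exists h : X -> X,
    ((forall x y, h x = h y -> x = y) /\ (forall y, exists x, h x = y)) /\
    forall x, ~ ~ exists (s : bool) (k : nat),
      if s
      then x = g (nat_rect (fun _ => X) (h x) (fun _ z => f (g z)) k)
      else h x = f (nat_rect (fun _ => X) x (fun _ z => g (f z)) k).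

Definition unique_choice (X : Type) : Prop := forall R : X -> X -> Prop,
  (forall x, exists y, R x y /\ forall y', R x y' -> y' = y) ->
  exists f : X -> X, forall x, R x (f x).

Lemma odd_double (n : nat) : odd (double n) = false.
Proof.
  induction n as [|n IH]; [reflexivity|].
  change (neg (neg (odd (double n))) = false). rewrite IH. reflexivity.
Defined.

Lemma it_double (X : Type) (T : X -> X) (n : nat) (x : X) :
  it X T (double n) x = nat_rect (fun _ => X) x (fun _ y => T (T y)) n.
Proof.
  induction n as [|n IH]; [reflexivity|].
  change (T (T (it X T (double n) x)) = T (T (nat_rect (fun _ => X) x (fun _ y => T (T y)) n))).
  rewrite IH. reflexivity.
Defined.

Lemma linked_of_orbit (X : Type) (T h : X -> X) :
  (forall x, ~ ~ exists (s : bool) (k : nat),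
      if s
      then x = T (nat_rect (fun _ => X) (h x) (fun _ z => T (T z)) k)
      else h x = T (nat_rect (fun _ => X) x (fun _ z => T (T z)) k)) ->
  oddly_linked X T h.
Proof.
  intros L x N. apply (L x). intros E. elim E. intros s K. elim K. intros k. intros F.
  (* With [f = g = T], the natural number [k] stands for the exponent 2k + 1 under either sign. *)
  apply N. exists (S (double k)). split.
  - change (neg (odd (double k)) = true). rewrite odd_double. reflexivity.
  - revert F. elim s; intros F.
    + right. change (x = T (it X T (double k) (h x))). rewrite it_double. exact F.
    + left. change (h x = T (it X T (double k) x)). rewrite it_double. exact F.
Defined.

(** Injectivity makes preimages unique, so unique choice yields the inverse. *)
Lemma bijection_inverse (X : Type) (h : X -> X) : unique_choice X ->
  (forall x y, h x = h y -> x = y) -> (forall y, exists x, h x = y) ->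
  exists k : X -> X, forall y, h (k y) = y.
Proof.
  intros U I S. apply (U (fun y x => h x = y)). intros y. elim (S y). intros x X'.
  exists x. split; [exact X'|]. intros x' E. apply I. rewrite E, X'. reflexivity.
Defined.

Lemma lpo_of_myhill (B : Type) (o i : B) (is_o : B -> bool) :
  is_o o = true -> is_o i = false ->
  (forall f g : nat -> B, (forall n, f n = g n) -> f = g) ->
  (forall f g : nat -> bool, (forall n, f n = g n) -> f = g) ->
  unique_choice (nat -> B) ->
  (forall p : nat -> bool, ~ p = (fun _ => false) -> exists n, p n = true) ->
  myhill (nat -> B) ->
  forall p : nat -> bool, p = (fun _ => false) \/ exists n, p n = true.
Proof.
  intros O I F F2 U M H p.
  pose proof (T_inj B F is_o) as inj.
  elim (H (T B is_o) (T B is_o) (conj inj inj)). intros h Hh.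
  elim (bijection_inverse (nat -> B) h U (proj1 (proj1 Hh)) (proj2 (proj1 Hh))). intros k hk.
  pose proof (linked_of_orbit (nat -> B) (T B is_o) h (proj2 Hh)) as L.
  apply (lpo_of_linked B F o i is_o O I h k hk).
  - intros x. apply (proj1 (proj1 Hh)). apply hk.
  - exact L.
  - exact (oddly_linked_inverse (nat -> B) (T B is_o) h k hk L).
  - exact F2.
  - exact M.
Defined.

Lemma lpo_of_markov_myhill :
  (forall f g : nat -> nat, (forall n, f n = g n) -> f = g) ->
  (forall f g : nat -> bool, (forall n, f n = g n) -> f = g) ->
  unique_choice (nat -> nat) -> unique_choice (nat -> bool) ->
  (forall p : nat -> bool, ~ p = (fun _ => false) -> exists n, p n = true) /\
  (myhill (nat -> nat) \/ myhill (nat -> bool)) ->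
  forall p : nat -> bool, p = (fun _ => false) \/ exists n, p n = true.
Proof.
  intros F F2 U U2 H. elim (proj2 H); intros K.
  - exact (lpo_of_myhill nat O (S O) (fun n => neg (positive n)) eq_refl eq_refl F F2 U (proj1 H) K).
  - exact (lpo_of_myhill bool false true neg eq_refl eq_refl F2 F2 U2 (proj1 H) K).
Defined.

(** * Assembling the derivation *)

Notation "<< x ; .. ; y >>" := (pair x .. (pair y tt) ..) (only parsing).

Ltac concat l m := lazymatch l with (?a, ?l) => let r := concat l m in constr:((a, r)) | tt => m end.
(** Lemmas with a type parameter are quoted once for [nat] and once for [bool]. Each lemma stands
    after those that its proof cites. *)
Ltac lemmas_at B := constr:(<<
  it_plus (nat -> B); it_inj (nat -> B); it_fix (nat -> B); oddly_linked_inverse (nat -> B);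
  linked_fix (nat -> B); chain_inj (nat -> B); chain_pred (nat -> B); chain_step (nat -> B);
  alt_flip (nat -> B); alt_window (nat -> B); alt_linked (nat -> B); parity_of_chain (nat -> B);
  tl_cons B; cons_ext B; evens_merge B; odds_merge B; merge_evens_odds B; evens_T B;
  odds_T B; T_inj B; T_ones B; neg_side_start B; back_0 B; T_back B; it_back B; neg_side_back B;
  back_initial B; neg_side_chain B; parity_first B; z_true B; z_false B; z_first B;
  crosses_fixed B; code_first B; parity_code B; parity_code_false B; lpo_of_window B; lpo_of_linked B;
  it_double (nat -> B); linked_of_orbit (nat -> B); bijection_inverse (nat -> B); lpo_of_myhill B >>).
Ltac all_lemmas :=
  let a := constr:(<< true_or_false; true_false; bool_ext; bool_stable; conj2_l; conj2_r; conj2_intro;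
  disj2_false_l; disj2_false_r; disj2_false; neg_true; neg_fix; plus_0; plus_S;
  xor_neg; odd_plus; lt_0; eqn_refl; eqn_eq; lt_succ; lt_irrefl; lt_S; lt_succ_cases; lt_diff; nlt_diff;
  lt_plus_r; lt_plus_l; first_true; G_false; some_from_false; some_from_true; all_some_from;
  upto_true; upto_plus; lpo_of_all_some_from; window_or_lpo;
  xor_false_r; xor_assoc; xor_swap; xor_cancel; xsum_ext; xsum_xor; xsum_plus; xsum_false; eqn_sym; xsum_eqn;
  xsum_eqn_iota; xsum_below; xsum_all; xsum_crossing; finite_choice; odd_double >>) in
  let b := lemmas_at nat in let c := lemmas_at bool in
  let d := constr:(<< lpo_of_markov_myhill >>) in
  let r := concat c d in let r := concat b r in let r := concat a r in r.


Definition proof_script : list (raw * pf) :=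
  ltac:(let l := all_lemmas in let r := qscript tt 0 l in exact r).

Definition funext_formula (t : ty) : tm [] Om :=
  All (Nn ~> t) (All (Nn ~> t) (All Nn (#2 @ #0 == #1 @ #0) ==> #1 == #0)).

Definition unique_choice_formula (s : ty) : tm [] Om :=
  All (s ~> s ~> Om)
    (All s (Ex s (#2 @ #1 @ #0 //\\ All s (#3 @ #2 @ #0 ==> #0 == #1))) ==>
     Ex (s ~> s) (All s (#2 @ #0 @ (#1 @ #0)))).

Lemma prv_funext (t : ty) : prv [] (funext_formula t).
Proof. apply pAllI, pAllI, pImpI, pFunExt, pAx. now left. Qed.

Lemma prv_unique_choice (s : ty) : prv [] (unique_choice_formula s).
Proof. apply pAllI, pImpI, (pUniqueChoice (R := Var vz)), pAx. now left. Qed.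

Theorem theorem50 :
  prv (G := []) []
    (Markov //\\ (nnStrongMyhill Baire \\// nnStrongMyhill Cantor) ==> LPO).
Proof.
  (* The last quoted lemma has function extensionality and unique choice as premises; the calculus
     derives these, and they are then cut away. *)
  assert (P : prv [] (funext_formula Nn ==> funext_formula Two ==>
    unique_choice_formula Baire ==> unique_choice_formula Cantor ==>
    Markov //\\ (nnStrongMyhill Baire \\// nnStrongMyhill Cantor) ==> LPO)).
  { apply (@proves_sound proof_script). vm_compute. reflexivity. }
  exact (pImpE (pImpE (pImpE (pImpE P (prv_funext Nn)) (prv_funext Two))
    (prv_unique_choice Baire)) (prv_unique_choice Cantor)).
Qed.
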